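(* Let $f$ be a field of characteristic $0$, $\lambda,\mu\in f$, and let $m$ be a non-negative integer. (1) If $\mu\ne(m+k+1)\lambda$ for all positive integers $k$, then $I_{\lambda\mu}^{m+1}=f[x_0,x_1,\dots,x_m]$. (2) If $\lambda=\mu=0$, then $I_{\lambda\mu}^{m+1}=f[x_0,x_1,\dots,x_{m+1}]$. (3) If $\lambda\ne0$, $\mu=(m+k+1)\lambda$ for a positive integer $k$, and $-1/\lambda\ne n$ for every positive integer $n<k$, then $I_{\lambda\mu}^{m+1}=f[x_0,x_1,\dots,x_m,P_{mk}^{(-1/\lambda)}(x_0,x_1,\dots,x_{m+k})]$, where the polynomial $P_{mk}^{(-1/\lambda)}$ is defined by the generating function $$\sum_{k=1}^{\infty}P_{mk}^{(-1/\lambda)}(x_0,x_1,\dots,x_{m+k})z^k=\frac{\left(\sum_{i=0}^{\infty}x_ix_0^{i-1}z^i\right)^{-1/\lambda}-\left(\sum_{i=0}^{m}x_ix_0^{i-1}z^i\right)^{-1/\lambda}}{x_0^mz^m}.$$ (4) If $-1/\lambda=n$ for a positive integer $n$ and $\mu=(m+k+1)\lambda$ for a positive integer $k>n$, then $I_{\lambda\mu}^{m+1}=f[x_0,x_1,\dots,x_m,P_{mk}^{(n)}(x_0,x_1,\dots,x_{m+k})/x_0^{k-n}]$, with $P_{mk}^{(n)}$ defined by the same generating function.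
   Context: $F_{\lambda\mu}=f[[t]]\,t^\mu(dt)^{-\lambda}$ is the topological $f$-space of formal generalized tensor fields, with topological basis $e_k=t^{k+\mu}(dt)^{-\lambda}$, $k=0,1,2,\dots$; $(x_k)_{k\ge0}$ is the dual basis of the space of continuous linear forms on $F_{\lambda\mu}$ (so $x_k$ is the $k$-th coefficient). For $m\ge1$, $G_m$ is the group of automorphisms $g$ of $f((t))$ over $f$ with $g(t)=t+o(t^m)$, where $o(t^m)$ denotes a series with all terms of degree $>m$; it acts on $F_{\lambda\mu}$ by substitution: $g\cdot\big(h(t)t^\mu(dt)^{-\lambda}\big)=h(g(t))\left(\frac{g(t)}{t}\right)^{\mu}\left(\frac{dg(t)}{dt}\right)^{-\lambda}t^\mu(dt)^{-\lambda}$, powers of series with constant term $1$ being defined by the binomial series. $L_m$ is the Lie algebra of formal vector fields $\sum_{i\ge m}a_il_i$, $l_i=t^{i+1}\frac{d}{dt}$, acting by Lie derivative, $l_ie_k=(k+\mu-\lambda(i+1))e_{k+i}$. $I_{\lambda\mu}^m\subset f[x_0,x_1,x_2,\dots]$ is the algebra of polynomial functions on $F_{\lambda\mu}$ that are invariant under these actions of $G_m$ and $L_m$. In the generating function the series raised to the power $-1/\lambda$ have constant term $1$ in $z$ and the power is given by the binomial series. *)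

(* Defs.v *)
From HB Require Import structures.
From mathcomp Require Import all_boot all_order all_algebra.
From mathcomp Require Import finmap boolp classical_sets.
From mathcomp Require Import monalg.

Set Implicit Arguments.
Unset Strict Implicit.
Unset Printing Implicit Defensive.

Import GRing.Theory.
Local Open Scope ring_scope.
Local Open Scope classical_set_scope.

(* The ring R[[t]]; the k-th coefficient of s is written s k. *)
Record fps (R : Type) : Type := Fps { fps_coef :> nat -> R }.

Notation "{ 'fps' R }" := (fps R)
  (at level 0, R at level 2, format "{ 'fps'  R }") : type_scope.

HB.instance Definition _ (R : Type) := gen_eqMixin {fps R}.
HB.instance Definition _ (R : Type) := gen_choiceMixin {fps R}.

Lemma fpsP (R : Type) (a b : {fps R}) : (forall k, a k = b k) -> a = b.
Proof. by case: a b => [a] [b] /= /funext ->. Qed.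

Section FpsRing.
Variable R : comNzRingType.
Implicit Types a b c : {fps R}.

Definition fps_zero : {fps R} := Fps (fun=> 0).
Definition fps_opp a : {fps R} := Fps (fun k => - a k).
Definition fps_add a b : {fps R} := Fps (fun k => a k + b k).
Definition fpsC (x : R) : {fps R} := Fps (fun k => x *+ (k == 0)).
Definition fps_mul a b : {fps R} :=
  Fps (fun k => \sum_(i < k.+1) a i * b (k - i)%N).

Fact fps_addA : associative fps_add.
Proof. by move=> a b c; apply: fpsP => k; apply: addrA. Qed.
Fact fps_addC : commutative fps_add.
Proof. by move=> a b; apply: fpsP => k; apply: addrC. Qed.
Fact fps_add0 : left_id fps_zero fps_add.
Proof. by move=> a; apply: fpsP => k; apply: add0r. Qed.
Fact fps_addN : left_inverse fps_zero fps_opp fps_add.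
Proof. by move=> a; apply: fpsP => k; apply: addNr. Qed.

HB.instance Definition _ :=
  GRing.isZmodule.Build {fps R} fps_addA fps_addC fps_add0 fps_addN.

Definition fps_trunc n a : {poly R} := \poly_(i < n) a i.

Fact fps_mulE n a b k : (k < n)%N ->
  fps_mul a b k = (fps_trunc n a * fps_trunc n b)`_k.
Proof.
move=> kn; rewrite coefM; apply: eq_bigr => i _.
have ik : (i <= k)%N by rewrite -ltnS.
by rewrite !coef_poly (leq_ltn_trans ik kn) (leq_ltn_trans (leq_subr i k) kn).
Qed.

Fact fps_mulA : associative fps_mul.
Proof.
move=> a b c; apply: fpsP => k; rewrite !(fps_mulE _ _ (ltnSn k)).
pose T := fps_trunc k.+1.
have TM d e (i : nat) : (i <= k)%N -> (T (fps_mul d e))`_i = (T d * T e)`_i.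
  by move=> ik; rewrite coef_poly ltnS ik (@fps_mulE k.+1).
transitivity ((T a * (T b * T c))`_k).
  rewrite !coefM; apply: eq_bigr => i _.
  by congr (_ * _); apply: TM; rewrite leq_subr.
rewrite mulrA !coefM; apply: eq_bigr => i _.
by congr (_ * _); rewrite TM // -ltnS.
Qed.

Fact fps_mulC : commutative fps_mul.
Proof.
by move=> a b; apply: fpsP => k; rewrite !(@fps_mulE k.+1) // mulrC.
Qed.

Fact fps_mul1 : left_id (fpsC 1) fps_mul.
Proof.
move=> a; apply: fpsP => k; rewrite /= big_ord_recl /= mul1r subn0.
by rewrite big1 ?addr0 // => i _; rewrite mul0r.
Qed.

Fact fps_mulDl : left_distributive fps_mul fps_add.
Proof.
move=> a b c; apply: fpsP => k; rewrite /= -big_split /=.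
by apply: eq_bigr => i _; rewrite mulrDl.
Qed.

Fact fps_one_neq0 : fpsC 1 != 0 :> {fps R}.
Proof. by apply/eqP => /(congr1 (fun a : {fps R} => a 0%N)) /eqP; rewrite /= oner_eq0. Qed.

HB.instance Definition _ := GRing.Zmodule_isComNzRing.Build {fps R}
  fps_mulA fps_mulC fps_mul1 fps_mulDl fps_one_neq0.

Definition fps_unit : pred {fps R} := fun a => `[< exists b, b * a = 1 >].
Definition fps_inv a : {fps R} :=
  if pselect (exists b, b * a = 1) is left h then sval (cid h) else a.

Fact fps_mulVr : {in fps_unit, left_inverse 1 fps_inv *%R}.
Proof.
move=> a; rewrite unfold_in => /asboolP ua; rewrite /fps_inv.
by case: pselect => // h; case: (cid h).
Qed.
Fact fps_unitPl a b : b * a = 1 -> fps_unit a.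
Proof. by move=> ab; apply/asboolP; exists b. Qed.
Fact fps_inv_out : {in [predC fps_unit], fps_inv =1 id}.
Proof.
move=> a; rewrite inE unfold_in => /asboolP nua; rewrite /fps_inv.
by case: pselect.
Qed.

HB.instance Definition _ := GRing.ComNzRing_hasMulInverse.Build {fps R}
  fps_mulVr fps_unitPl fps_inv_out.

Definition fpsX : {fps R} := Fps (fun k => (k == 1)%:R).

(* The derivative da/dt. *)
Definition fps_deriv a : {fps R} := Fps (fun k => a k.+1 *+ k.+1).

(* a / t, for a series a without constant term. *)
Definition fps_divX a : {fps R} := Fps (fun k => a k.+1).

(* The substitution a(b(t)), for a series b without constant term: b ^+ n has
   no term of degree < n, so the n-th summand is 0 at degree k < n. *)
Definition fps_comp a b : {fps R} :=
  Fps (fun k => \sum_(n < k.+1) a n * (b ^+ n) k).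

End FpsRing.

Arguments fpsX {R}.

Fact fps_idomain (R : idomainType) :
  GRing.integral_domain_axiom {fps R}.
Proof.
move=> a b ab0; apply/norP => -[a0 b0].
have nz (c : {fps R}) : c != 0 -> exists k, c k != 0.
  move=> /eqP c0; apply: contrapT => nc; apply: c0; apply: fpsP => k /=.
  by apply/eqP/negPn/negP => ck; apply: nc; exists k.
case: (ex_minnP (nz _ a0)) => i ai imin.
case: (ex_minnP (nz _ b0)) => j bj jmin.
have := congr1 (fun c : {fps R} => c (i + j)%N) ab0; rewrite /=.
have ij : (i < (i + j).+1)%N by rewrite ltnS leq_addr.
rewrite (bigD1 (Ordinal ij)) //= addKn big1 => [/eqP|l /eqP li].
  by rewrite addr0 mulf_eq0 (negPf ai) (negPf bj).
have [lti|gti|eqi] := ltngtP l i.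
- have [->|/imin] := eqVneq (a l) 0; first by rewrite mul0r.
  by rewrite leqNgt lti.
- have [->|/jmin] := eqVneq (b (i + j - l)%N) 0; first by rewrite mulr0.
  rewrite leqNgt ltn_subLR ?ltn_add2r ?gti //.
  by rewrite -ltnS ltn_ord.
- by case: li; apply: val_inj.
Qed.

HB.instance Definition _ (R : idomainType) :=
  GRing.ComUnitRing_isIntegral.Build {fps R} (@fps_idomain R).

(* The field f((t)) is represented as the fraction field of f[[t]]. *)
Notation laurent f := {fraction {fps f}}.

(* sum_n binomial(alpha, n) t^n *)
Definition binomial_fps (f : fieldType) (alpha : f) : {fps f} :=
  Fps (fun n => (\prod_(i < n) (alpha - i%:R)) / n`!%:R).

(* a ^ alpha, for a series a with constant term 1 over an f-algebra R; the
   f-algebra structure of R is given by iota. *)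
Definition fps_binpow (f : fieldType) (R : comNzRingType) (iota : f -> R)
    (a : {fps R}) (alpha : f) : {fps R} :=
  fps_comp (Fps (fun n => iota (binomial_fps alpha n))) (a - 1).

(* The polynomial ring f[x_0, x_1, ...] in countably many variables. *)
Notation polyring f := {malg f[{cmonom nat}]}.

Definition xvar (f : fieldType) (k : nat) : polyring f := << ucm k >>.

(* The value p(v 0, v 1, ...) in an f-algebra R. *)
Definition peval (f : fieldType) (R : comNzRingType) (iota : f -> R)
    (v : nat -> R) (p : polyring f) : R :=
  mmap iota (fun M : {cmonom nat} => \prod_(i <- finsupp M) v i ^+ M i) p.

(* The subalgebra generated by S. *)
Definition subalg_gen (f : fieldType) (A : lalgType f) (S : set A) : set A :=
  smallest [set B : set A | GRing.subalg_closed (mem B)] S.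

Section Invariants.
Variables (f : fieldType) (lambda mu : f).

(* An element h(t) t^mu (dt)^(-lambda) of F_{lambda,mu} is represented by the
   series h, so that the coordinate x_k is h |-> h k. *)

(* sigma is the element of G_m (m >= 1) with sigma(t) = g(t) = t + o(t^m). *)
Definition in_G (m : nat) (sigma : {rmorphism laurent f -> laurent f})
    (g : {fps f}) : Prop :=
  [/\ bijective sigma,
      forall c : f, sigma (FracField.tofrac (fpsC c)) = FracField.tofrac (fpsC c),
      sigma (FracField.tofrac fpsX) = FracField.tofrac g
    & forall i, (i <= m)%N -> g i = (fpsX : {fps f}) i].

Definition G_act (g h : {fps f}) : {fps f} :=
  fps_comp h g * fps_binpow idfun (fps_divX g) mu
    * fps_binpow idfun (fps_deriv g) (- lambda).

(* The action of sum_i (a i) l_i on F_{lambda,mu}, obtained from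
   l_i e_k = (k + mu - lambda (i + 1)) e_(k + i). *)
Definition L_act (a h : {fps f}) : {fps f} :=
  Fps (fun n => \sum_(i < n.+1)
    a i * h (n - i)%N * ((n - i)%N%:R + mu - lambda * i.+1%:R)).

(* The derivative of p at the point h in the direction of the vector v, i.e. the
   coefficient of e in p(h + e v). *)
Definition dir_deriv (p : polyring f) (h v : {fps f}) : f :=
  (peval polyC (fun k => (h k)%:P + v k *: 'X) p)`_1.

Definition invariants (m : nat) : set (polyring f) :=
  [set p |
    (forall sigma g, in_G m sigma g ->
       forall h : {fps f}, peval idfun (G_act g h) p = peval idfun h p) /\
    (forall a : {fps f}, (forall i, (i < m)%N -> a i = 0) ->
       forall h : {fps f}, dir_deriv p h (L_act a h) = 0)].

End Invariants.

Section GeneratingFunction.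
Variable f : fieldType.

(* sum_(i >= 0) x_i x_0^(i-1) z^i, whose i = 0 term is x_0 x_0^(-1) = 1. *)
Definition Yseries : {fps polyring f} :=
  Fps (fun i => if i is j.+1 then xvar f i * xvar f 0 ^+ j else 1).

Definition Yseries_upto (m : nat) : {fps polyring f} :=
  Fps (fun i => if (i <= m)%N then Yseries i else 0).

(* P = sum_(k >= 1) P_{mk}^{(alpha)} z^k; the defining equation is multiplied by
   its denominator x_0^m z^m, a non-zero-divisor. *)
Definition is_genfun (m : nat) (alpha : f) (P : {fps polyring f}) : Prop :=
  P 0%N = 0 /\
  fpsC (xvar f 0 ^+ m) * fpsX ^+ m * P =
    fps_binpow (in_alg (polyring f)) Yseries alpha
    - fps_binpow (in_alg (polyring f)) (Yseries_upto m) alpha.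

End GeneratingFunction.

(* Main.v *)
Require Import Defs.
From mathcomp Require Import all_boot all_order all_algebra.
From mathcomp Require Import finmap boolp classical_sets.
From mathcomp Require Import monalg.
From mathcomp Require Import ring zify.
From HB Require Import structures.
Import GRing.Theory.
Local Open Scope ring_scope.
Local Open Scope classical_set_scope.

(** Write n = m + k and alpha = - 1 / lambda.

    Invariance of the generators.  A substitution g = t + o(t^(m+1)) has
    g / t and g' equal to 1 below degree m + 1, so it fixes x_0, ..., x_m.  If
    mu = (n + 1) lambda and h has constant term 1, the action on h turns h^alpha
    into h(g)^alpha (g / t)^-(n+1) g'; as the residue of h^alpha t^-(n+1) dt does
    not change under substitution ([residue_subst]), the coefficient of t^n in
    h^alpha is invariant ([binpow_gact_coef]).  The substitution of x_0 z for z
    carries this over to an arbitrary nonzero constant term ([Yser_gact]).  The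
    series truncated at degree m depends on x_0, ..., x_m only, so the difference
    in the generating function has an invariant coefficient at degree n, and x_0^m
    can be cancelled from it.  The explicit form [relpoly] of the quotient also
    shows the role of the binomial coefficients: if those of alpha with index
    d + 1, ..., k vanish, as in the last assertion, where alpha is a positive
    integer d < k, then a further factor x_0^(k-d) splits off.

    All of this is done over an arbitrary domain R containing f
    ([absolute_invariant]).  For R = f it is invariance under the group; for
    R = f[s] and the curve of substitutions t + s a(t) t it gives, to first order
    in s, invariance under the Lie algebra.

    No other invariants.  A polynomial is constant along a curve that is everywhere
    tangent to the directions of the Lie algebra ([peval_path_const]).  Since
    l_i e_0 = (mu - lambda (i + 1)) e_i, these directions are all those that fix
    x_0, ..., x_m wherever x_0 is not 0, as long as no scalar
    mu - lambda (i + 1) with i > m vanishes ([L_act_solve]).  So the remaining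
    coordinates may be scaled down to 0 without changing the value of an invariant
    ([invariant_truncated]); for lambda = mu = 0 the same works one step later,
    with e_1 in the role of e_0.  If mu = (n + 1) lambda, exactly the scalar for
    i = n vanishes.  The other coordinates can still be scaled down to 0 if x_n
    moves in such a way that the additional generator Q keeps its value
    ([invariant_normal_form]).  As Q is linear in x_n, with a scalar times a power
    of x_0 as the coefficient, an invariant multiplied by a power of x_0 is a polynomial in
    x_0, ..., x_m and Q ([invariant_localized]).  The power of x_0 can be removed
    because Q stays transcendental over x_1, ..., x_m after setting x_0 = 0
    ([relcoef_line_nonconst], [adjoin_saturated]). *)

Set Implicit Arguments.
Unset Strict Implicit.
Unset Printing Implicit Defensive.

(** * Formal power series *)

Section FpsTheory.
Variable R : comNzRingType.
Implicit Types (a b c w : {fps R}) (p q : {poly R}).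

Lemma fps_coefM a b k : (a * b) k = \sum_(i < k.+1) a i * b (k - i)%N.
Proof. by []. Qed.

Lemma fps_coef1 k : (1 : {fps R}) k = (k == 0%N)%:R.
Proof. by []. Qed.

Lemma fps_coefMn a n k : (a *+ n) k = a k *+ n.
Proof. by elim: n => // n IHn; rewrite !mulrS -IHn. Qed.

Lemma fps_coef_sum (I : Type) (r : seq I) (P : pred I) (F : I -> {fps R}) k :
  (\sum_(i <- r | P i) F i) k = \sum_(i <- r | P i) F i k.
Proof. by elim/big_rec2: _ => // i y x _ <-. Qed.

Fact fpsC_zmod : zmod_morphism (@fpsC R).
Proof. by move=> x y; apply: fpsP => k /=; rewrite mulrnBl. Qed.

Lemma fps_coefCM (x : R) a k : (fpsC x * a) k = x * a k.
Proof.
rewrite fps_coefM big_ord_recl subn0 big1 ?addr0 //= => i _.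
by rewrite mul0r.
Qed.

Fact fpsC_monoid : monoid_morphism (@fpsC R).
Proof.
split=> // x y; apply: fpsP => k; rewrite fps_coefCM /=.
by rewrite mulrnAr.
Qed.

HB.instance Definition _ :=
  GRing.isZmodMorphism.Build R {fps R} (@fpsC R) fpsC_zmod.
HB.instance Definition _ :=
  GRing.isMonoidMorphism.Build R {fps R} (@fpsC R) fpsC_monoid.

Lemma fps_coefXM a k : (fpsX * a) k = if k is k'.+1 then a k' else 0.
Proof.
rewrite fps_coefM; case: k => [|k]; first by rewrite big_ord1 mul0r.
rewrite !big_ord_recl /= mul0r add0r mul1r subn1 big1 ?addr0 // => i _.
by rewrite mul0r.
Qed.

Lemma fps_coefXnM n a k :
  (fpsX ^+ n * a) k = if (k < n)%N then 0 else a (k - n)%N.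
Proof.
elim: n k => [|n IHn] k; first by rewrite mul1r subn0.
by rewrite exprS -mulrA fps_coefXM; case: k => [|k] //; rewrite IHn.
Qed.

Lemma fps_coefM0 a b : (a * b) 0%N = a 0%N * b 0%N.
Proof. by rewrite fps_coefM big_ord1. Qed.

Lemma fps_coefX0 a n : (a ^+ n) 0%N = a 0%N ^+ n.
Proof. by elim: n => // n IHn; rewrite !exprS fps_coefM0 IHn. Qed.

Lemma fps_XdivX a : a 0%N = 0 -> a = fpsX * fps_divX a.
Proof. by move=> a0; apply: fpsP => -[|k]; rewrite fps_coefXM. Qed.

Lemma fps_coefX_lt a n k : a 0%N = 0 -> (k < n)%N -> (a ^+ n) k = 0.
Proof. by move=> a0 kn; rewrite (fps_XdivX a0) exprMn fps_coefXnM kn. Qed.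

(** Congruence modulo t^n. *)
Definition fps_cong n a b := forall i, (i < n)%N -> a i = b i.

Lemma fps_congM n a a' b b' :
  fps_cong n a a' -> fps_cong n b b' -> fps_cong n (a * b) (a' * b').
Proof.
move=> aa bb k kn; rewrite !fps_coefM; apply: eq_bigr => i _.
by rewrite aa ?bb // ?(leq_ltn_trans (leq_subr _ _)) // (leq_trans (ltn_ord i)).
Qed.

Lemma fps_congX n a a' j : fps_cong n a a' -> fps_cong n (a ^+ j) (a' ^+ j).
Proof. by move=> aa; elim: j => // j IHj; rewrite !exprS; apply: fps_congM. Qed.

Lemma coef_pow_addXn (T : {fps R}) (c : R) n j : (0 < n)%N ->
  ((T + fpsC c * fpsX ^+ n) ^+ j) n = (T ^+ j) n + c * T 0%N ^+ j.-1 *+ j.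
Proof.
move=> n_gt0; set A := T + _.
have AT : fps_cong n A T.
  move=> i ltin; rewrite -[LHS]/(T i + (fpsC c * fpsX ^+ n) i) mulrC fps_coefXnM.
  by rewrite ltin addr0.
elim: j => [|j IHj]; first by rewrite addr0.
have -> : (A ^+ j.+1) n = (T * A ^+ j) n + c * T 0%N ^+ j.
  rewrite exprS mulrDl -[LHS]/((T * A ^+ j) n + _ n) -mulrA fps_coefCM.
  by rewrite fps_coefXnM ltnn subnn fps_coefX0 AT.
rewrite exprS !fps_coefM !big_ord_recl !subn0 IHj mulrDr.
rewrite (eq_bigr (fun i : 'I_n => T (lift ord0 i) * (T ^+ j) (n - lift ord0 i)%N)).
  case: j {IHj} => [|j] /=; rewrite ?mulr0n ?mulr0 ?addr0 //.
  by rewrite mulrnAr mulrCA -exprS -!addrA; congr (_ + _);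
    rewrite addrC -addrA -mulrS.
by move=> i _; rewrite (fps_congX j AT) //= /bump; lia.
Qed.

Definition poly_fps p : {fps R} := Fps (fun i => p`_i).

Lemma poly_fpsM p q : poly_fps (p * q) = poly_fps p * poly_fps q.
Proof. by apply: fpsP => k; rewrite /= coefM. Qed.

Lemma fps_trunc_cong n a : fps_cong n a (poly_fps (fps_trunc n a)).
Proof. by move=> i ltin; rewrite /= coef_poly ltin. Qed.
Arguments fps_trunc_cong : clear implicits.

(** Each coefficient only sees a truncation of the series, so that the identity
    for polynomials implies the one for series. *)
Lemma fps_derivM a b :
  fps_deriv (a * b) = fps_deriv a * b + a * fps_deriv b.
Proof.
apply: fpsP => k.
have T c := fps_trunc_cong k.+2 c.
have dT c : fps_cong k.+1 (fps_deriv c)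
    (poly_fps (fps_trunc k.+2 c)^`()).
  by move=> i ik /=; rewrite coef_deriv coef_poly !ltnS -ltnS ik.
have T1 c : fps_cong k.+1 c (poly_fps (fps_trunc k.+2 c)).
  by move=> i ik; apply: T; apply: ltnW.
have -> : fps_deriv (a * b) k = (a * b) k.+1 *+ k.+1 by [].
rewrite (fps_congM (T a) (T b)) // -poly_fpsM /= -coef_deriv derivM coefD.
congr (_ + _); rewrite -[LHS]/(poly_fps (_ * _) k) poly_fpsM; apply/esym.
  exact: (fps_congM (dT a) (T1 b)).
exact: (fps_congM (T1 a) (dT b)).
Qed.

Lemma fps_derivX a n : fps_deriv (a ^+ n) = a ^+ n.-1 * fps_deriv a *+ n.
Proof.
elim: n => [|n IHn].
  by apply: fpsP => k; rewrite /= mul0rn.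
rewrite exprS fps_derivM IHn /=.
case: n {IHn} => [|n]; first by rewrite mulr0n mulr0 addr0 mulrC.
by rewrite [in RHS]mulrS mulrC mulrnAr mulrA -exprS.
Qed.

Lemma fps_compE N a b k : b 0%N = 0 -> (k < N)%N ->
  fps_comp a b k = \sum_(i < N) a i * (b ^+ i) k.
Proof.
move=> b0 kN /=; rewrite (big_ord_widen N (fun i => a i * (b ^+ i) k)) //.
rewrite [RHS](bigID (fun i : 'I_N => (i < k.+1)%N)) /= [X in _ + X]big1 ?addr0//.
by move=> i; rewrite -leqNgt => ki; rewrite fps_coefX_lt ?mulr0.
Qed.

Lemma fps_compMl a b w k : b 0%N = 0 ->
  (fps_comp a b * w) k = \sum_(i < k.+1) a i * (b ^+ i * w) k.
Proof.
move=> b0; rewrite fps_coefM.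
under [RHS]eq_bigr => i _ do rewrite fps_coefM mulr_sumr.
rewrite [RHS]exchange_big; apply: eq_bigr => i _.
rewrite (@fps_compE k.+1) // mulr_suml; apply: eq_bigr => j _.
by rewrite mulrA.
Qed.

Lemma fps_comp_congl n a a' b :
  fps_cong n a a' -> fps_cong n (fps_comp a b) (fps_comp a' b).
Proof.
move=> aa k kn /=; apply: eq_bigr => i _; rewrite aa //.
by rewrite (leq_trans _ kn).
Qed.

Lemma fps_comp_congr n a b b' :
  fps_cong n b b' -> fps_cong n (fps_comp a b) (fps_comp a b').
Proof. by move=> bb k kn /=; apply: eq_bigr => i _; rewrite (fps_congX i bb). Qed.

(** Evaluation of polynomials is a ring morphism; through this lemma,
    substitution into a series becomes one. *)
Lemma fps_comp_poly p b : b 0%N = 0 ->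
  fps_comp (poly_fps p) b = (map_poly (@fpsC R) p).[b].
Proof.
move=> b0; apply: fpsP => k.
rewrite (@fps_compE (maxn k.+1 (size p))) ?leq_max ?ltnSn //.
rewrite (@horner_coef_wide _ (maxn k.+1 (size p))); last first.
  by rewrite (leq_trans (size_poly _ _)) ?leq_max ?leqnn ?orbT.
rewrite fps_coef_sum; apply: eq_bigr => i _.
by rewrite coef_map fps_coefCM.
Qed.

Lemma fps_compM a c b : b 0%N = 0 ->
  fps_comp (a * c) b = fps_comp a b * fps_comp c b.
Proof.
move=> b0; apply: fpsP => k.
have T d := fps_trunc_cong k.+1 d.
rewrite (fps_comp_congl b (fps_congM (T a) (T c))) //.
rewrite -poly_fpsM fps_comp_poly // rmorphM hornerM -!fps_comp_poly //.
apply/esym.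
exact: (fps_congM (fps_comp_congl b (T a)) (fps_comp_congl b (T c))).
Qed.

Lemma fps_compD a c b : fps_comp (a + c) b = fps_comp a b + fps_comp c b.
Proof.
by apply: fpsP => k; rewrite /= -big_split; apply: eq_bigr => i _; rewrite mulrDl.
Qed.

Lemma fps_compC x b : fps_comp (fpsC x) b = fpsC x.
Proof.
apply: fpsP => k; rewrite /= big_ord_recl big1 ?addr0 => [|i _].
  by rewrite expr0 fps_coef1 mulr_natr.
by rewrite mul0r.
Qed.

Lemma fps_comp1 b : fps_comp 1 b = 1.
Proof. exact: fps_compC. Qed.

Lemma fps_comp_idr a : fps_comp a fpsX = a.
Proof.
apply: fpsP => k; rewrite /= (bigD1 ord_max) //= -[fpsX ^+ k]mulr1.
rewrite fps_coefXnM ltnn subnn mulr1 big1 ?addr0 // => i.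
rewrite -val_eqE /= => ik; rewrite -[fpsX ^+ i]mulr1 fps_coefXnM.
case: ltnP => [_|ki]; first by rewrite mulr0.
by rewrite fps_coef1 subn_eq0 leqNgt ltn_neqAle ik ki mulr0.
Qed.

Lemma fps_comp_idl b : b 0%N = 0 -> fps_comp fpsX b = b.
Proof.
move=> b0; apply: fpsP => k; rewrite (@fps_compE k.+2) //.
rewrite !big_ord_recl /= mul0r add0r mul1r expr1 big1 ?addr0 // => i _.
by rewrite mul0r.
Qed.

Lemma fps_comp_0 a b : fps_comp a b 0%N = a 0%N.
Proof. by rewrite /= big_ord1 mulr1. Qed.

Lemma fps_chain a b : b 0%N = 0 ->
  fps_deriv (fps_comp a b) = fps_comp (fps_deriv a) b * fps_deriv b.
Proof.
move=> b0; apply: fpsP => k; rewrite fps_compMl // /=.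
rewrite big_ord_recl /= mulr0 add0r -sumrMnl; apply: eq_bigr => i _ /=.
have := congr1 (fun c : {fps R} => c k) (fps_derivX b i.+1) => /= d.
by rewrite -mulrnAr d mulrnAl fps_coefMn mulrnAr.
Qed.

End FpsTheory.

(** * Binomial powers and residues *)

Section CharacteristicZero.
Variables (f : fieldType) (char0 : [pchar f] =i pred0).
Implicit Types s alpha : f.

Lemma natf0 n : n.+1%:R != 0 :> f.
Proof. by have/pcharf0P-> := char0. Qed.

Lemma natr_inj : injective (fun n : nat => n%:R : f).
Proof.
have nat0 n : (n%:R == 0 :> f) = (n == 0%N) by have /pcharf0P -> := char0.
move=> i j; wlog leij : i j / (i <= j)%N.
  by move=> W; case/orP: (leq_total i j) => [/W //|/W W' /esym /W'].
move/esym/eqP; rewrite -subr_eq0 -natrB // nat0 subn_eq0 => leji.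
by apply/eqP; rewrite eqn_leq leij.
Qed.

Lemma binomial_fps0 (s : f) : binomial_fps s 0%N = 1.
Proof. by rewrite /= big_ord0 fact0 divr1. Qed.

Lemma binomial_fps1 (s : f) : binomial_fps s 1%N = s.
Proof. by rewrite /= big_ord1 subr0 divr1. Qed.

Lemma binomial_fpsS s n :
  binomial_fps s n.+1 *+ n.+1 = (s - n%:R) * binomial_fps s n.
Proof.
rewrite -[LHS]mulr_natr /= big_ord_recr /= factS natrM.
have n0 := natf0 n.
have nf0 : n`!%:R != 0 :> f by case: n`! (fact_gt0 n) => // i _; apply: natf0.
by rewrite invfM [n.+1%:R^-1 * _]mulrC !mulrA divfK // mulrAC mulrC mulrA.
Qed.

Lemma binomial_fps_neq0 alpha n :
  (forall i, (i < n)%N -> alpha != i%:R) -> binomial_fps alpha n != 0.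
Proof.
move=> alphaN; rewrite /= mulf_neq0 //.
  by apply/prodf_neq0 => i _; rewrite subr_eq0 alphaN.
by rewrite invr_eq0; case: n`! (fact_gt0 n) => // i _; apply: natf0.
Qed.

Lemma binomial_fps_eq0 n j : (n < j)%N -> binomial_fps (n%:R : f) j = 0.
Proof. by move=> nj; rewrite /= (bigD1 (Ordinal nj)) //= subrr !mul0r. Qed.

End CharacteristicZero.

Section BinomialPower.
Variables (f : fieldType) (char0 : [pchar f] =i pred0).
Variables (R : idomainType) (iota : {rmorphism f -> R}).
Implicit Types (a b e d g v w : {fps R}) (s t : f).

Lemma mulrSn_eq0 (x : R) n : x *+ n.+1 = 0 -> x = 0.
Proof.
move/eqP; rewrite -mulr_natr mulf_eq0 -(rmorph_nat iota) fmorph_eq0.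
by rewrite (negPf (natf0 char0 n)) orbF => /eqP.
Qed.

(** The equation determines the coefficients of a solution one by one, because
    the constant term of a and the positive integers are invertible. *)
Lemma fps_ode_eq0 a e d : a 0%N = 1 -> d 0%N = 0 ->
  a * fps_deriv d = e * d -> d = 0.
Proof.
move=> a0 d0 ode; apply: fpsP => k /=.
elim/ltn_ind: k => -[//|k] IHk.
have := congr1 (fun c : {fps R} => c k) ode; rewrite !fps_coefM.
rewrite big_ord_recl /= a0 mul1r subn0 big1 ?addr0; last first.
  by move=> i _; rewrite IHk ?mul0rn ?mulr0 // /bump /= add1n ltnS ltn_subrL;
     case: (k) i => [[]|].
rewrite big1 => [/mulrSn_eq0 //|i _].
by rewrite IHk ?mulr0 // ltnS leq_subr.
Qed.

Definition binpow := fps_binpow iota.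

Definition binomR s : {fps R} := Fps (fun n => iota (binomial_fps s n)).

Lemma binpowE a s : binpow a s = fps_comp (binomR s) (a - 1).
Proof. by []. Qed.

Lemma binomR_ode s :
  (1 + fpsX) * fps_deriv (binomR s) = fpsC (iota s) * binomR s.
Proof.
apply: fpsP => k; rewrite fps_coefCM mulrDl mul1r.
rewrite -[LHS]/(fps_deriv (binomR s) k + (fpsX * fps_deriv (binomR s)) k).
rewrite fps_coefXM -[fps_deriv _ _]/(iota (binomial_fps s k.+1) *+ k.+1).
rewrite -rmorphMn (binomial_fpsS char0) -[binomR s k]/(iota _).
case: k => [|k]; first by rewrite subr0 addr0 rmorphM.
rewrite -[fps_deriv _ _]/(iota (binomial_fps s k.+1) *+ k.+1).
by rewrite -rmorphMn -rmorphD -rmorphM mulrBl mulr_natl subrK.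
Qed.

Lemma sub1_coef0 a : a 0%N = 1 -> (a - 1) 0%N = 0.
Proof. by move=> a0; rewrite -[LHS]/(a 0%N - 1) a0 subrr. Qed.

Lemma binpow_0 a s : binpow a s 0%N = 1.
Proof. by rewrite binpowE fps_comp_0 /= big_ord0 fact0 divr1 rmorph1. Qed.

Lemma fps_deriv_sub1 a : fps_deriv (a - 1) = fps_deriv a.
Proof. by apply: fpsP => k /=; rewrite oppr0 addr0. Qed.

Lemma binpow_ode a s : a 0%N = 1 ->
  a * fps_deriv (binpow a s) = fpsC (iota s) * fps_deriv a * binpow a s.
Proof.
move=> a0; have b0 := sub1_coef0 a0.
rewrite binpowE fps_chain // fps_deriv_sub1 mulrA.
have {1}-> : a = fps_comp (1 + fpsX) (a - 1).
  by rewrite fps_compD fps_comp1 fps_comp_idl // addrC subrK.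
rewrite -fps_compM // binomR_ode fps_compM // fps_compC.
by rewrite -!mulrA [X in _ * X]mulrC.
Qed.

(** The binomial power a^s is the only solution b of a b' = s a' b with constant
    term 1; all the rules for powers are deduced from this. *)
Lemma binpow_uniq a b s : a 0%N = 1 -> b 0%N = 1 ->
  a * fps_deriv b = fpsC (iota s) * fps_deriv a * b -> b = binpow a s.
Proof.
move=> a0 b0 ode; apply/eqP; rewrite -subr_eq0; apply/eqP.
apply: (@fps_ode_eq0 a (fpsC (iota s) * fps_deriv a)) => //.
  by rewrite -[LHS]/(b 0%N - binpow a s 0%N) b0 binpow_0 subrr.
rewrite mulrBr -ode -binpow_ode // -mulrBr; congr (_ * _).
by apply: fpsP => k /=; rewrite mulrnBl.
Qed.

Lemma fps_coef0_neq0 a : a 0%N = 1 -> a != 0.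
Proof.
move=> a0; apply/eqP => az; move: a0; rewrite az => /esym/eqP.
by rewrite oner_eq0.
Qed.

Lemma binpow0 a : a 0%N = 1 -> binpow a 0 = 1.
Proof.
move=> a0; apply/esym/binpow_uniq => //; rewrite rmorph0 /= rmorph0 !mul0r.
by apply: fpsP => k; rewrite fps_coefM big1 // => i _ /=; rewrite mul0rn mulr0.
Qed.

Lemma binpow1 a : a 0%N = 1 -> binpow a 1 = a.
Proof. by move=> a0; apply/esym/binpow_uniq => //; rewrite !rmorph1 mul1r mulrC. Qed.

Lemma binpowD a s t : a 0%N = 1 -> binpow a (s + t) = binpow a s * binpow a t.
Proof.
move=> a0; apply/esym/binpow_uniq => //; first by rewrite fps_coefM0 !binpow_0 mulr1.
rewrite fps_derivM mulrDr mulrA binpow_ode // mulrCA binpow_ode // !rmorphD.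
by ring.
Qed.

Lemma binpowMl a b s : a 0%N = 1 -> b 0%N = 1 ->
  binpow (a * b) s = binpow a s * binpow b s.
Proof.
move=> a0 b0; apply/esym/binpow_uniq; rewrite ?fps_coefM0 ?binpow_0 ?a0 ?b0 ?mulr1 //.
transitivity (b * binpow b s * (a * fps_deriv (binpow a s)) +
    a * binpow a s * (b * fps_deriv (binpow b s))).
  rewrite fps_derivM; move: (fps_deriv _) (fps_deriv _) => da db.
  by move: (binpow a s) (binpow b s) => u v; ring.
rewrite !binpow_ode // fps_derivM; move: (binpow a s) (binpow b s) => u v.
by move: (fps_deriv a) (fps_deriv b) (fpsC _) => da db c; ring.
Qed.

Lemma binpow_binpow a s t : a 0%N = 1 ->
  binpow (binpow a s) t = binpow a (s * t).
Proof.
move=> a0; set u := binpow a s; apply: binpow_uniq; rewrite ?binpow_0 //.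
have u0 : u 0%N = 1 by apply: binpow_0.
apply: (mulfI (fps_coef0_neq0 u0)); rewrite mulrCA binpow_ode //.
transitivity (fpsC (iota t) * (a * fps_deriv u) * binpow u t); first by ring.
by rewrite binpow_ode // -/u !rmorphM /=; ring.
Qed.

Lemma fps_comp_binpow a b s : a 0%N = 1 -> b 0%N = 0 ->
  fps_comp (binpow a s) b = binpow (fps_comp a b) s.
Proof.
move=> a0 b0; apply: binpow_uniq; first by rewrite fps_comp_0.
  by rewrite (fps_comp_0 (binpow a s)) binpow_0.
rewrite !(fps_chain _ b0) mulrA -fps_compM // binpow_ode // !fps_compM // fps_compC.
by rewrite -!mulrA; congr (_ * (_ * _)); rewrite mulrC.
Qed.

Lemma fps_deriv_X : fps_deriv (fpsX : {fps R}) = 1.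
Proof. by apply: fpsP => -[|k] //=; rewrite mul0rn. Qed.

(** For r > 0 this coefficient is that of t^-1 in an exact differential,
    namely a multiple of d((t v)^-r). *)
Lemma residue_exact v r : v 0%N = 1 ->
  (binpow v (- r.+1%:R) * (v + fpsX * fps_deriv v)) r = (r == 0%N)%:R.
Proof.
move=> v0; set V := binpow v _; set W := binpow v (- r%:R).
have WE : V * v = W.
  transitivity (V * binpow v 1); first by rewrite binpow1.
  by rewrite -binpowD // -natr1 opprD addrNK.
rewrite mulrDr WE.
case: (posnP r) => [r0|r_gt0].
  rewrite -[LHS]/(W r + (V * (fpsX * fps_deriv v)) r) mulrCA.
  by rewrite fps_coefXM r0 addr0 binpow_0.
have E : fpsC (iota r%:R) * (V * fps_deriv v) = - fps_deriv W.
  apply: (mulfI (fps_coef0_neq0 v0)); rewrite mulrN binpow_ode // -/W -WE.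
  by rewrite !rmorphN /=; ring.
case: r r_gt0 V W WE E => // r _ V W WE E.
apply: (@mulrSn_eq0 _ r).
rewrite -[LHS]/((W r.+1 + (V * (fpsX * fps_deriv v)) r.+1) *+ r.+1).
rewrite mulrCA fps_coefXM mulrnDl.
have := congr1 (fun c : {fps R} => c r) E; rewrite fps_coefCM rmorph_nat.
by rewrite mulr_natl => ->; rewrite -[X in _ + X]/(- (W r.+1 *+ r.+1)) subrr.
Qed.

(** Invariance of the residue of H t^-(n+1) dt under the substitution of
    t v for t, where v has constant term 1. *)
Lemma residue_subst H v n : v 0%N = 1 ->
  (fps_comp H (fpsX * v) *
    (binpow v (- n.+1%:R) * fps_deriv (fpsX * v))) n = H n.
Proof.
move=> v0; have g0 : (fpsX * v) 0%N = 0 by rewrite fps_coefXM.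
have dg : fps_deriv (fpsX * v) = v + fpsX * fps_deriv v.
  by rewrite fps_derivM fps_deriv_X mul1r.
have E i : (i <= n)%N ->
    ((fpsX * v) ^+ i * (binpow v (- n.+1%:R) * fps_deriv (fpsX * v))) n
    = (i == n)%:R.
  move=> lein; rewrite exprMn -mulrA fps_coefXnM ifN -?leqNgt // mulrA dg.
  have -> : v ^+ i * binpow v (- n.+1%:R) = binpow v (- (n - i).+1%:R).
    rewrite -subSn // natrB ?leqW // opprB addrC.
    elim: (i) => [|j IHj]; first by rewrite mul1r addr0.
    by rewrite exprS -mulrA IHj [j.+1%:R]mulrS addrCA [RHS]binpowD // binpow1.
  by rewrite residue_exact // subn_eq0 eqn_leq lein.
rewrite fps_compMl // (eq_bigr (fun i : 'I_n.+1 => H i * (i == n :> nat)%:R)).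
  rewrite (bigD1 ord_max) //= eqxx mulr1 big1 ?addr0 // => i.
  by rewrite -val_eqE /= => /negPf ->; rewrite mulr0.
by move=> i _; rewrite E // -ltnS.
Qed.

End BinomialPower.

(** * Polynomials in countably many variables *)

Section Evaluation.
Variables (f : fieldType) (R : comNzRingType) (iota : {rmorphism f -> R}).
Variable v : nat -> R.

Definition monom_eval (M : {cmonom nat}) : R :=
  \prod_(i <- finsupp M) v i ^+ M i.

Lemma monom_evalEw (d : {fset nat}) (M : {cmonom nat}) :
  (finsupp M `<=` d)%fset -> monom_eval M = \prod_(i <- d) v i ^+ M i.
Proof.
by move=> Md; apply: big_fset_incl => // i _; rewrite -cmE_eq0 => /eqP ->.
Qed.

Fact monom_eval_mmorphism : mmorphism monom_eval.
Proof.
split=> [M M'|]; last by rewrite /monom_eval mdom1 big_nil.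
rewrite (monom_evalEw (d := finsupp (mmul M M'))) ?fsubset_refl //.
rewrite (monom_evalEw (d := finsupp (mmul M M')) (M := M)) ?mdomD ?fsubsetUl //.
rewrite (monom_evalEw (d := finsupp (mmul M M')) (M := M'))
  ?mdomD ?fsubsetUr //.
by rewrite -big_split; apply: eq_bigr => i _; rewrite cmM exprD.
Qed.

HB.instance Definition _ :=
  isMultiplicative.Build {cmonom nat} R monom_eval monom_eval_mmorphism.

HB.instance Definition _ :=
  GRing.RMorphism.copy (peval iota v) (mmap iota monom_eval).

Lemma pevalX i : peval iota v (xvar f i) = v i.
Proof.
rewrite -[LHS]/(mmap iota monom_eval _) mmapU.
rewrite -[LHS]/(iota 1 * monom_eval (ucm i)) rmorph1 mul1r /monom_eval mdomU.
by rewrite big_seq_fset1 cmUU.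
Qed.

Lemma pevalC c : peval iota v c%:A = iota c.
Proof.
rewrite -[LHS]/(mmap iota monom_eval _) mmapZ.
by rewrite -[LHS]/(iota c * peval iota v 1) rmorph1 mulr1.
Qed.

Lemma pevalD p q : peval iota v (p + q) = peval iota v p + peval iota v q.
Proof. exact: rmorphD. Qed.

Lemma pevalM p q : peval iota v (p * q) = peval iota v p * peval iota v q.
Proof. exact: rmorphM. Qed.

Lemma pevalXn p n : peval iota v (p ^+ n) = peval iota v p ^+ n.
Proof. exact: rmorphXn. Qed.

End Evaluation.

Section PolynomialRing.
Variable f : fieldType.
Implicit Types (p q : polyring f).

Lemma polyring_ind (P : polyring f -> Prop) :
  (forall c : f, P c%:A) -> (forall i, P (xvar f i)) ->
  (forall p q, P p -> P q -> P (p + q)) ->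
  (forall p q, P p -> P q -> P (p * q)) -> forall p, P p.
Proof.
move=> PC PX PD PM.
have PU n : forall M : {cmonom nat}, (mdeg M < n)%N -> P << M >>.
  elim: n => // n IHn M ltMn; have [/eqP|M0] := eqVneq (mdeg M) 0%N.
    rewrite mdeg_eq0 => /eqP ->; have := PC 1.
    by rewrite scale1r.
  have [i Mi] : exists i, M i != 0%N.
    have : finsupp M != fset0.
      by apply: contraNneq M0 => M0; rewrite mdegE M0 big_nil.
    by case/fset0Pn => i; rewrite -cmE_neq0; exists i.
  have ME : M = mmul (ucm i) (divcm M (ucm i)).
    apply/eqP/cmP => j; rewrite cmM cmU divcmE cmU.
    by case: eqP => [<-|_] /=; rewrite ?add0n ?subn0 // subnKC // lt0n.
  have -> : << M >> = xvar f i * << divcm M (ucm i) >> :> polyring f.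
    have := @fgmulUU _ f 1 1 (ucm i) (divcm M (ucm i)).
    by rewrite -ME mulr1 => <-.
  apply: PM => //; apply: IHn; move: ltMn; rewrite {1}ME mdegM mdegU.
  by rewrite add1n.
move=> p; rewrite (monalgE p).
apply: big_ind => [|//|M _]; first by rewrite -(scale0r (1 : polyring f)).
have -> : << p@_M *g M >> = (p@_M)%:MP * << M >> :> polyring f.
  have := @fgmulUU _ f (p@_M) 1 mone M.
  by rewrite mulr1 mul1m => <-.
have -> : (p@_M)%:MP = (p@_M)%:A :> polyring f by rewrite -mul_malgC mulr1.
by apply: PM => //; apply: PU (ltnSn _).
Qed.

Lemma rmorph_peval (R S : comNzRingType) (phi : {rmorphism R -> S})
    (iota : {rmorphism f -> R}) (iota' : {rmorphism f -> S}) v p :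
  (forall c, phi (iota c) = iota' c) ->
  phi (peval iota v p) = peval iota' (phi \o v) p.
Proof.
move=> phiE; elim/polyring_ind: p => [c|i|p q IHp IHq|p q IHp IHq].
- by rewrite !pevalC.
- by rewrite !pevalX.
- by rewrite !pevalD rmorphD IHp IHq.
- by rewrite !pevalM rmorphM IHp IHq.
Qed.

(** Substitution of polynomials for the variables. *)
Definition psubst (w : nat -> polyring f) : polyring f -> polyring f :=
  peval (in_alg (polyring f)) w.

HB.instance Definition _ w := GRing.RMorphism.on (psubst w).

Lemma psubstX w i : psubst w (xvar f i) = w i.
Proof. exact: pevalX. Qed.

Lemma psubstC w c : psubst w c%:A = c%:A.
Proof. exact: pevalC. Qed.

Lemma psubstD w p q : psubst w (p + q) = psubst w p + psubst w q.
Proof. exact: rmorphD. Qed.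

Lemma psubstM w p q : psubst w (p * q) = psubst w p * psubst w q.
Proof. exact: rmorphM. Qed.

Lemma peval_psubst (R : comNzRingType) (iota : {rmorphism f -> R}) v w p :
  peval iota v (psubst w p) = peval iota (fun i => peval iota v (w i)) p.
Proof. by apply: rmorph_peval => c; rewrite /= pevalC. Qed.

Lemma psubst_comp u w p :
  psubst u (psubst w p) = psubst (fun i => psubst u (w i)) p.
Proof. exact: peval_psubst. Qed.

Lemma eq_peval (R : comNzRingType) (iota : {rmorphism f -> R}) u v p :
  (forall i, u i = v i) -> peval iota u p = peval iota v p.
Proof. by move=> /funext ->. Qed.

(** A polynomial p involves x_0, ..., x_(N-1) only if and only if
    [psubst (truncvar N) p = p]. *)
Definition truncvar (N i : nat) : polyring f :=
  if (i < N)%N then xvar f i else 0.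

Lemma psubst0 w : psubst w 0 = 0.
Proof. exact: rmorph0. Qed.

Lemma eq_psubst w w' p : (forall i, w i = w' i) -> psubst w p = psubst w' p.
Proof. by move=> /funext ->. Qed.

Lemma truncvar_le N N' p : (N <= N')%N ->
  psubst (truncvar N) p = p -> psubst (truncvar N') p = p.
Proof.
move=> NN' Np; rewrite -{1}Np psubst_comp -[RHS]Np; apply: eq_peval => i.
rewrite /truncvar; case: ltnP => iN; last by rewrite rmorph0.
by rewrite psubstX (leq_trans iN).
Qed.

Lemma truncvar_ex p : exists N, psubst (truncvar N) p = p.
Proof.
elim/polyring_ind: p => [c|i|p q [N Np] [N' Nq]|p q [N Np] [N' Nq]].
- by exists 0%N; rewrite [LHS]pevalC.
- by exists i.+1; rewrite psubstX /truncvar ltnSn.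
- exists (maxn N N'); rewrite rmorphD /=.
  by rewrite !(truncvar_le _ Np, truncvar_le _ Nq) ?leq_maxl ?leq_maxr.
- exists (maxn N N'); rewrite rmorphM /=.
  by rewrite !(truncvar_le _ Np, truncvar_le _ Nq) ?leq_maxl ?leq_maxr.
Qed.

Lemma peval_truncvar (R : comNzRingType) (iota : {rmorphism f -> R}) u v N p :
  psubst (truncvar N) p = p -> (forall i, (i < N)%N -> u i = v i) ->
  peval iota u p = peval iota v p.
Proof.
move=> <- uv; rewrite !peval_psubst; apply: eq_peval => i.
by rewrite /truncvar; case: ltnP => iN; rewrite ?rmorph0 // !pevalX uv.
Qed.

(** A subalgebra generated by a sequence of polynomials is the image of the
    substitution of this sequence for the variables. *)
Lemma subalg_gen_range (w : nat -> polyring f) :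
  subalg_gen (range w) = range (psubst w).
Proof.
apply/seteqP; split.
  apply: smallest_sub; last first.
    by move=> _ [i _ <-]; exists (xvar f i); rewrite ?psubstX.
  split=> [|c _ _ /set_mem[p _ <-] /set_mem[q _ <-]|
           _ _ /set_mem[p _ <-] /set_mem[q _ <-]]; apply/mem_set.
  - by exists 1; rewrite ?rmorph1.
  - exists (c *: p + q) => //; rewrite psubstD; congr (_ + _).
    by rewrite -mulr_algl psubstM psubstC mulr_algl.
  - by exists (p * q); rewrite ?psubstM.
move=> _ [p _ <-] B [[B1 Blin BM] wB].
have {}B1 : B 1 by apply/set_mem.
have {}Blin c a b : B a -> B b -> B (c *: a + b).
  by move=> Ba Bb; apply/set_mem; apply: Blin; apply/mem_set.
have {}BM a b : B a -> B b -> B (a * b).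
  by move=> Ba Bb; apply/set_mem; apply: BM; apply/mem_set.
have B0 : B 0 by rewrite -(addNr 1) -scaleN1r; apply: Blin.
elim/polyring_ind: p => [c|i|p q IHp IHq|p q IHp IHq].
- by rewrite psubstC -[c%:A]addr0; apply: Blin.
- by rewrite psubstX; apply: wB; exists i.
- by rewrite psubstD -[X in X + _]scale1r; apply: Blin.
- by rewrite psubstM; apply: BM.
Qed.

Definition killvar (i j : nat) : polyring f := if j == i then 0 else xvar f j.

Lemma psubst_killvar i p : exists q, p = psubst (killvar i) p + xvar f i * q.
Proof.
elim/polyring_ind: p => [c|j|p q [p' Ep] [q' Eq]|p q [p' Ep] [q' Eq]].
- by exists 0; rewrite psubstC mulr0 addr0.
- rewrite psubstX /killvar; have [->|_] := eqVneq j i.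
    by exists 1; rewrite add0r mulr1.
  by exists 0; rewrite mulr0 addr0.
- exists (p' + q'); rewrite {1}Ep {1}Eq psubstD mulrDr.
  exact: addrACA.
- exists (psubst (killvar i) p * q' + p' * psubst (killvar i) q
    + xvar f i * p' * q').
  rewrite {1}Ep {1}Eq psubstM.
  by move: (psubst _ p) (psubst _ q) (xvar f i) => a b x; ring.
Qed.

Hypothesis char0 : [pchar f] =i pred0.

Lemma poly_horner_eq0 (a : f) (P : {poly f}) :
  (forall c, c != a -> P.[c] = 0) -> P = 0.
Proof.
move=> P0; apply/eqP; apply: contraT => Pn0.
pose Q := P * ('X - a%:P).
have Qn0 : Q != 0 by rewrite mulf_neq0 ?polyXsubC_eq0.
have := max_poly_roots (rs := [seq i%:R | i <- iota 0 (size Q)]) Qn0.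
rewrite size_map size_iota ltnn; apply.
  apply/allP => c _; rewrite rootE hornerM hornerXsubC mulf_eq0.
  by case: (eqVneq c a) => [->|/P0 ->]; rewrite ?subrr eqxx ?orbT.
by rewrite map_inj_uniq ?iota_uniq //; exact: natr_inj.
Qed.

(** The coefficients of p with respect to its last variable vanish at every
    point, because p vanishes for all the infinitely many values of this variable;
    they have one variable less. *)
Lemma peval_eq0_bounded N p : psubst (truncvar N) p = p ->
  (forall h : nat -> f, peval idfun h p = 0) -> p = 0.
Proof.
elim: N p => [|N IHN] p Np p0.
  rewrite -Np /psubst; have := p0 (fun=> 0).
  move=> /(congr1 (in_alg (polyring f))).
  rewrite (@rmorph_peval _ _ _ _ (in_alg (polyring f))) //= scale0r => <-.
  by apply: eq_peval => i; rewrite /truncvar /= scale0r.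
pose w i : {poly polyring f} := if (i < N)%N then (xvar f i)%:P
  else if i == N then 'X else 0.
pose ioX := (polyC \o in_alg (polyring f) : {rmorphism f -> {poly polyring f}})%FUN.
(* q is p read as a polynomial in its last variable. *)
pose q := peval ioX w p.
have pq : p = q.[xvar f N].
  rewrite -{1}Np; have -> : q.[xvar f N] = horner_eval (xvar f N) q by [].
  rewrite (@rmorph_peval _ _ _ _ (in_alg (polyring f))) => [|c]; last first.
    by rewrite /= /horner_eval hornerC.
  apply: eq_peval => i; rewrite /= /horner_eval /w /truncvar ltnS leq_eqVlt.
  have [->|_] := eqVneq i N; first by rewrite ltnn hornerX.
  by case: ltnP => _; rewrite /= hornerE.
suff q0 : q = 0 by rewrite pq q0 horner0.
apply/polyP => j; rewrite coef0; apply: IHN.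
  rewrite -[LHS](coef_map (psubst (truncvar N))); congr (nth _ (polyseq _) _).
  rewrite (@rmorph_peval _ _ _ _ ioX) => [|c]; last first.
    by rewrite /= map_polyC /= [psubst _ _]pevalC.
  rewrite [RHS](_ : q = peval ioX w p) //; apply: eq_peval => i.
  rewrite /= /w; case: ltnP => iN.
    by rewrite map_polyC /= psubstX /truncvar iN.
  by case: ifP => _; rewrite ?map_polyX ?rmorph0.
move=> h; rewrite -coef_map.
suff -> : map_poly (peval idfun h) q = 0 by rewrite coef0.
apply: (@poly_horner_eq0 0) => c _.
have -> : (map_poly (peval idfun h) q).[c] = peval idfun
    (fun i => if (i < N)%N then h i else if i == N then c else 0) p.
  rewrite (@rmorph_peval _ _ _ _ polyC) => [|d]; last first.
    by rewrite /= map_polyC /= pevalC.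
  rewrite -[LHS]/(horner_eval c _).
  rewrite (@rmorph_peval _ _ _ _ idfun) => [|d]; last first.
    by rewrite /= /horner_eval hornerC.
  apply: eq_peval => i; rewrite /= /w /horner_eval; case: ltnP => iN.
    by rewrite map_polyC /= pevalX hornerC.
  by case: ifP => _; rewrite ?map_polyX ?hornerX // rmorph0 horner0.
exact: p0.
Qed.

(** Points with a nonzero i-th coordinate are dense: on a line in the direction
    of this coordinate, p vanishes at all points but one. *)
Lemma peval_eq0 (i : nat) p :
  (forall h : nat -> f, h i != 0 -> peval idfun h p = 0) -> p = 0.
Proof.
move=> p0; have [N Np] := truncvar_ex p.
apply: (peval_eq0_bounded Np) => h.
pose P := peval polyC (fun j => (h j)%:P + (j == i)%:R *: 'X) p.
have PE c : P.[c] = peval idfun (fun j => h j + (j == i)%:R * c) p.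
  have -> : P.[c] = horner_eval c P by [].
  rewrite (@rmorph_peval _ _ _ _ idfun) => [|d]; last first.
    by rewrite /= /horner_eval hornerC.
  by apply: eq_peval => j; rewrite /= /horner_eval hornerD hornerC hornerZ hornerX.
have P0 : P = 0.
  apply: (@poly_horner_eq0 (- h i)) => c hc; rewrite PE; apply: p0.
  by rewrite eqxx mul1r addrC addr_eq0.
have := PE 0; rewrite P0 horner0 => ->.
by apply: eq_peval => j; rewrite mulr0 addr0.
Qed.

Lemma peval_inj (i : nat) p q :
  (forall h : nat -> f, h i != 0 -> peval idfun h p = peval idfun h q) -> p = q.
Proof.
move=> pq; apply/eqP; rewrite -subr_eq0; apply/eqP; apply: (@peval_eq0 i) => h hi.
by rewrite rmorphB /= pq // subrr.
Qed.

Lemma mulfI_xvarX (i n : nat) :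
  injective (fun p => xvar f i ^+ n * p).
Proof.
move=> p q pq; apply: (peval_inj (i := i)) => h hi.
have E a : peval idfun h (xvar f i ^+ n * a) = h i ^+ n * peval idfun h a.
  by rewrite pevalM pevalXn pevalX.
apply: (mulfI (expf_neq0 n hi)); rewrite -(E p) -(E q).
exact: (congr1 (peval idfun h) pq).
Qed.

End PolynomialRing.

(** * First-order variation and the Lie algebra *)

Section FirstOrder.
Variables (f : fieldType).
Implicit Types (p : polyring f) (h v w a : {fps f}).

(** Congruence modulo 'X ^+ 2. *)
Definition eq_jet (P Q : {poly f}) := P`_0 = Q`_0 /\ P`_1 = Q`_1.

Lemma coefM_jet (P Q : {poly f}) :
  ((P * Q)`_0 = P`_0 * Q`_0) * ((P * Q)`_1 = P`_0 * Q`_1 + P`_1 * Q`_0).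
Proof. by rewrite !coefM big_ord1 !big_ord_recl big_ord0 addr0. Qed.

Lemma peval_jet (u v : nat -> {poly f}) p :
  (forall i, eq_jet (u i) (v i)) -> eq_jet (peval polyC u p) (peval polyC v p).
Proof.
move=> uv; elim/polyring_ind: p => [c|i|p q [p0 p1] [q0 q1]|p q [p0 p1] [q0 q1]].
- by rewrite !pevalC.
- by rewrite !pevalX.
- by rewrite !pevalD; split; rewrite !coefD ?p0 ?p1 ?q0 ?q1.
- by rewrite !pevalM; split; rewrite !coefM_jet ?p0 ?p1 ?q0 ?q1.
Qed.

Lemma comp_shift_jet (P : {poly f}) s :
  eq_jet (P \Po ('X + s%:P)) (P.[s]%:P + P^`().[s] *: 'X).
Proof.
have E Q : (Q \Po ('X + s%:P))`_0 = Q.[s].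
  by rewrite -horner_coef0 horner_comp hornerD hornerX hornerC add0r.
have d (Q : {poly f}) : Q`_1 = Q^`()`_0 by rewrite coef_deriv mulr1n.
split; first by rewrite E coefD coefC coefZ coefX mulr0 addr0.
rewrite d deriv_comp derivD derivX derivC addr0 mulr1 E.
by rewrite coefD coefC coefZ coefX add0r mulr1.
Qed.

(** The chain rule: the curve gamma (s + 'X) agrees to first order with its
    tangent line at s. *)
Lemma peval_path_deriv (gamma : nat -> {poly f}) p s :
  (peval polyC gamma p)^`().[s] =
  dir_deriv p (Fps (fun k => (gamma k).[s])) (Fps (fun k => (gamma k)^`().[s])).
Proof.
have := (comp_shift_jet (peval polyC gamma p) s).2.
rewrite coefD coefC coefZ coefX add0r mulr1 => <-.
rewrite -[_ \Po _]/(comp_poly ('X + s%:P) _).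
rewrite (@rmorph_peval _ _ _ _ _ polyC) => [|c]; last by rewrite /= comp_polyC.
by apply: (peval_jet _ _).2 => k; apply: comp_shift_jet.
Qed.

Lemma dir_deriv_truncvar N p h v w : psubst (truncvar f N) p = p ->
  (forall i, (i < N)%N -> v i = w i) -> dir_deriv p h v = dir_deriv p h w.
Proof.
move=> Np vw; congr (nth _ (polyseq _) _).
by apply: (peval_truncvar _ Np) => i iN; rewrite vw.
Qed.

Lemma poly_deriv_const (char0 : [pchar f] =i pred0) (P : {poly f}) :
  (forall s, P^`().[s] = 0) -> forall s, P.[s] = P.[0].
Proof.
move=> dP s; have {}dP : P^`() = 0 by apply: (poly_horner_eq0 char0 (a := 0)).
suff -> : P = (P`_0)%:P by rewrite !hornerC.
apply/polyP => -[|i]; rewrite coefC //=.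
have /eqP := congr1 (fun Q : {poly f} => Q`_i) dP.
rewrite coef_deriv coef0 -mulr_natr mulf_eq0.
by have /pcharf0P -> := char0; rewrite orbF => /eqP.
Qed.

(** A polynomial is constant along a curve as soon as its derivative at every
    point of the curve vanishes in the direction of the tangent. *)
Lemma peval_path_const (char0 : [pchar f] =i pred0) (gamma : nat -> {poly f}) p s :
  (forall s, dir_deriv p (Fps (fun k => (gamma k).[s]))
                         (Fps (fun k => (gamma k)^`().[s])) = 0) ->
  peval idfun (fun k => (gamma k).[s]) p = peval idfun (fun k => (gamma k).[0]) p.
Proof.
move=> dp; have E c : peval idfun (fun k => (gamma k).[c]) p =
    (peval polyC gamma p).[c].
  rewrite -[RHS]/(horner_eval c _) (@rmorph_peval _ _ _ _ _ idfun) //= => d.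
  by rewrite /horner_eval hornerC.
by rewrite !E; apply: poly_deriv_const => // c; rewrite peval_path_deriv.
Qed.

End FirstOrder.

(** The action of the group over any f-algebra; for [iota = idfun] it is [G_act]
    by conversion. *)
Definition gact (f : fieldType) (R : comNzRingType) (iota : f -> R)
    (lambda mu : f) (g h : {fps R}) : {fps R} :=
  fps_comp h g * fps_binpow iota (fps_divX g) mu
    * fps_binpow iota (fps_deriv g) (- lambda).

(** Invariance with coefficients in every domain over f.  Domains other than f
    are needed for the first-order variation, over f[s], and for the passage to
    series with a nonzero constant term, over R[X]. *)
Definition absolute_invariant (f : fieldType) (lambda mu : f) (m : nat)
    (p : polyring f) : Prop :=
  forall (R : idomainType) (iota : {rmorphism f -> R}) (g h : {fps R}),
    fps_cong m.+1 g fpsX ->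
    peval iota (gact iota lambda mu g h) p = peval iota h p.

Section Infinitesimal.
Variables (f : fieldType) (lambda mu : f).
Implicit Types (A B W : {fps {poly f}}) (a h : {fps f}).

(** The parts of A of degree 0 and 1 in the polynomial variable. *)
Definition jet0 A : {fps f} := Fps (fun n => (A n)`_0).
Definition jet1 A : {fps f} := Fps (fun n => (A n)`_1).

Lemma jet0M A B : jet0 (A * B) = jet0 A * jet0 B.
Proof.
by apply: fpsP => k /=; rewrite coef_sum; apply: eq_bigr => i _; rewrite coefM_jet.
Qed.

Lemma jet1M A B : jet1 (A * B) = jet0 A * jet1 B + jet1 A * jet0 B.
Proof.
apply: fpsP => k /=; rewrite coef_sum -big_split.
by apply: eq_bigr => i _; rewrite coefM_jet.
Qed.

Lemma jet0_1 : jet0 1 = 1.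
Proof. by apply: fpsP => -[|k] /=; rewrite coefMn coef1. Qed.

Lemma jet1_1 : jet1 1 = 0.
Proof. by apply: fpsP => -[|k] /=; rewrite coefMn coef1 mul0rn. Qed.

Lemma jet0X A n : jet0 (A ^+ n) = jet0 A ^+ n.
Proof. by elim: n => [|n IHn]; rewrite ?jet0_1 // !exprS jet0M IHn. Qed.

Lemma jet1X A n : jet1 (A ^+ n) = jet0 A ^+ n.-1 * jet1 A *+ n.
Proof.
elim: n => [|n IHn]; first by rewrite jet1_1.
rewrite exprS jet1M IHn jet0X /=; case: n {IHn} => [|n].
  by rewrite mulr0n mulr0 add0r mulrC.
by rewrite [in RHS]mulrSr mulrnAr mulrA -exprS [jet1 A * _]mulrC.
Qed.

Definition lift_fps h : {fps {poly f}} := Fps (fun k => (h k)%:P).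

Lemma jet0_comp h A : jet0 (fps_comp (lift_fps h) A) = fps_comp h (jet0 A).
Proof.
apply: fpsP => k /=; rewrite coef_sum; apply: eq_bigr => i _.
by rewrite coefCM -jet0X.
Qed.

Lemma jet1_comp h A k : jet1 (fps_comp (lift_fps h) A) k =
  \sum_(i < k.+1) h i * jet1 (A ^+ i) k.
Proof.
by rewrite /= coef_sum; apply: eq_bigr => i _; rewrite coefCM.
Qed.

Lemma jet0_binpow W s : jet0 W = 1 -> jet0 (fps_binpow polyC W s) = 1.
Proof.
move=> W0; rewrite -[fps_binpow _ _ _]/(fps_comp (lift_fps (binomial_fps s)) _).
rewrite jet0_comp; have -> : jet0 (W - 1) = fpsC 0.
  apply: fpsP => k /=; rewrite coefB.
  have := congr1 (fun A : {fps f} => A k) W0 => /= ->.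
  by rewrite coefMn coef1 subrr mul0rn.
apply: fpsP => k; rewrite [LHS]big_ord_recl big1 ?addr0 => [|i _].
  by rewrite binomial_fps0 mul1r.
by rewrite exprS rmorph0 mul0r mulr0.
Qed.

Lemma jet1_binpow W s : jet0 W = 1 -> W 0%N = 1 ->
  jet1 (fps_binpow polyC W s) = fpsC s * jet1 W.
Proof.
move=> W0 W1; rewrite -[fps_binpow _ _ _]/(fps_comp (lift_fps (binomial_fps s)) _).
have j0 : jet0 (W - 1) = 0.
  apply: fpsP => k /=; rewrite coefB.
  have := congr1 (fun A : {fps f} => A k) W0 => /= ->.
  by rewrite coefMn coef1 subrr.
have j1 : jet1 (W - 1) = jet1 W.
  by apply: fpsP => k /=; rewrite coefB coefMn coef1 mul0rn subr0.
have J0 n : jet1 ((W - 1) ^+ 0) n = 0 by rewrite expr0 jet1_1.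
apply: fpsP => k; rewrite jet1_comp fps_coefCM.
case: k => [|k]; first by rewrite big_ord1 J0 mulr0 /= W1 coef1 mulr0.
rewrite 2!big_ord_recl J0 mulr0 add0r big1 ?addr0 => [|i _].
  by rewrite expr1 j1 binomial_fps1.
by rewrite jet1X j0 [_.-1]/= exprS !mul0r mul0rn mulr0.
Qed.

(** The curve of substitutions t + s t a(t), with s the polynomial variable. *)
Definition flow a : {fps {poly f}} :=
  Fps (fun i => if i is j.+1 then (j == 0%N)%:R + a j *: 'X else 0).

Lemma jet0_flow a : jet0 (flow a) = fpsX.
Proof.
apply: fpsP => -[|k] /=; first by rewrite coef0.
by rewrite coefD coefZ coefX mulr0 addr0 coefMn coef1.
Qed.

Lemma jet1_flow a : jet1 (flow a) = fpsX * a.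
Proof.
apply: fpsP => -[|k]; rewrite fps_coefXM /= ?coef0 //.
by rewrite coefD coefZ coefX mulr1 coefMn coef1 mul0rn add0r.
Qed.

(** As derivatives at s = 0, the three factors of the action contribute the terms
    in k, mu and - lambda (i + 1) of the formula for l_i e_k. *)
Lemma jet_gact a h : a 0%N = 0 ->
  jet0 (gact polyC lambda mu (flow a) (lift_fps h)) = h /\
  jet1 (gact polyC lambda mu (flow a) (lift_fps h)) = L_act lambda mu a h.
Proof.
move=> a0.
have c0 : jet0 (fps_comp (lift_fps h) (flow a)) = h.
  by rewrite jet0_comp jet0_flow fps_comp_idr.
have jX i k : (i <= k)%N -> jet1 (flow a ^+ i) k = a (k - i)%N *+ i.
  rewrite jet1X jet0_flow jet1_flow; case: i => [|i] ik; first by rewrite !mulr0n.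
  by rewrite fps_coefMn mulrA -exprSr fps_coefXnM ifN -?leqNgt.
have c1 : jet1 (fps_comp (lift_fps h) (flow a)) = a * Fps (fun n => h n *+ n).
  apply: fpsP => k; rewrite jet1_comp mulrC fps_coefM; apply: eq_bigr => i _.
  by rewrite jX -1?ltnS // mulrnAr -mulrnAl.
have d0 : jet0 (fps_divX (flow a)) = 1.
  apply: fpsP => k /=; rewrite coefD coefZ coefX mulr0 addr0 coefMn coef1.
  by [].
have d1 : jet1 (fps_divX (flow a)) = a.
  by apply: fpsP => k /=; rewrite coefD coefZ coefX mulr1 coefMn coef1 mul0rn add0r.
have e0 : jet0 (fps_deriv (flow a)) = 1.
  apply: fpsP => k /=; rewrite coefMn coefD coefZ coefX mulr0 addr0 coefMn coef1.
  by case: k => [|k]; rewrite ?mulr0n ?mul0rn.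
have e1 : jet1 (fps_deriv (flow a)) = Fps (fun i => a i *+ i.+1).
  apply: fpsP => k /=; rewrite coefMn coefD coefZ coefX mulr1 coefMn coef1.
  by rewrite mul0rn add0r.
have d01 : fps_divX (flow a) 0%N = 1 by rewrite /= a0 scale0r addr0.
have e01 : fps_deriv (flow a) 0%N = 1 by rewrite /= a0 scale0r addr0.
have [b0 b1] := (jet0_binpow mu d0, jet0_binpow (- lambda) e0).
have j0 : jet0 (fps_comp (lift_fps h) (flow a) *
    fps_binpow polyC (fps_divX (flow a)) mu) = h by rewrite jet0M c0 b0 mulr1.
split; first by rewrite /gact jet0M j0 b1 mulr1.
have j1 : jet1 (fps_comp (lift_fps h) (flow a) *
    fps_binpow polyC (fps_divX (flow a)) mu) =
    h * (fpsC mu * a) + a * Fps (fun n => h n *+ n).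
  by rewrite jet1M c0 c1 b0 (jet1_binpow _ d0 d01) d1 mulr1.
rewrite /gact jet1M j0 b1 j1 (jet1_binpow _ e0 e01) e1 mulr1.
apply: fpsP => n.
rewrite -[LHS]/((h * _) n + ((h * _) n + (a * _) n)).
rewrite mulrCA [h * (fpsC mu * _)]mulrCA !fps_coefCM [h * _]mulrC [h * a]mulrC.
transitivity (\sum_(i < n.+1) (- lambda * (a i *+ i.+1 * h (n - i)%N) +
    (mu * (a i * h (n - i)%N) + a i * (h (n - i)%N *+ (n - i))))).
  by rewrite !big_split -!mulr_sumr.
apply: eq_bigr => i _; rewrite -[a i *+ _]mulr_natr -[h _ *+ _]mulr_natr.
by move: (a i) (h _) (i.+1%:R) ((n - i)%:R) => x y z t; ring.
Qed.

(** For the Lie algebra, p is constant along the curve of points that [flow a]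
    makes of h; the tangent of this curve at h is [L_act a h]. *)
Lemma absolute_invariant_invariants m p : (0 < m)%N ->
  absolute_invariant lambda mu m p -> invariants lambda mu m p.
Proof.
move=> m_gt0 pinv; split=> [sigma g [_ _ _ gX] h|a a0 h].
  by apply: pinv => i; rewrite ltnS => /gX.
have [g0 g1] := jet_gact h (a0 _ m_gt0).
have gX : fps_cong m.+1 (flow a) fpsX.
  move=> [|i] // im; rewrite /= a0 ?scale0r ?addr0 //.
have -> : dir_deriv p h (L_act lambda mu a h) =
    (peval polyC (gact polyC lambda mu (flow a) (lift_fps h)) p)`_1.
  apply: (peval_jet _ _).2 => k.
  split; rewrite coefD coefC coefZ coefX ?mulr0 ?mulr1 ?addr0 ?add0r.
    by rewrite -{1}g0.
  by rewrite -g1.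
rewrite pinv // (_ : peval _ _ _ = (peval idfun h p)%:P) ?coefC //.
by rewrite (@rmorph_peval _ _ _ _ _ polyC).
Qed.

End Infinitesimal.

(** * The coefficients of the generating function *)

Section Map.
Variables (f : fieldType) (R S : comNzRingType) (phi : {rmorphism R -> S}).
Variables (iotaR : {rmorphism f -> R}) (iotaS : {rmorphism f -> S}).
Hypothesis phi_iota : forall c, phi (iotaR c) = iotaS c.
Implicit Types a b : {fps R}.

Definition fps_map a : {fps S} := Fps (fun i => phi (a i)).

Lemma fps_mapM a b : fps_map (a * b) = fps_map a * fps_map b.
Proof.
apply: fpsP => k /=; rewrite rmorph_sum; apply: eq_bigr => i _.
by rewrite rmorphM.
Qed.

Lemma fps_map1 : fps_map 1 = 1.
Proof. by apply: fpsP => k /=; rewrite rmorphMn rmorph1. Qed.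

Lemma fps_mapX a n : fps_map (a ^+ n) = fps_map a ^+ n.
Proof. by elim: n => [|n IHn]; rewrite ?fps_map1 // !exprS fps_mapM IHn. Qed.

Lemma fps_map_comp a b : fps_map (fps_comp a b) = fps_comp (fps_map a) (fps_map b).
Proof.
apply: fpsP => k /=; rewrite rmorph_sum; apply: eq_bigr => i _.
by rewrite rmorphM -fps_mapX.
Qed.

Lemma fps_map_binpow a s :
  fps_map (fps_binpow iotaR a s) = fps_binpow iotaS (fps_map a) s.
Proof.
rewrite /fps_binpow fps_map_comp; congr fps_comp.
  by apply: fpsP => k /=; rewrite phi_iota.
by apply: fpsP => k /=; rewrite rmorphB /= rmorphMn rmorph1.
Qed.

Lemma fps_map_gact lambda mu a b :
  fps_map (gact iotaR lambda mu a b) =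
  gact iotaS lambda mu (fps_map a) (fps_map b).
Proof.
rewrite /gact !fps_mapM fps_map_comp !fps_map_binpow.
congr (_ * fps_binpow _ _ _).
by apply: fpsP => k /=; rewrite rmorphMn.
Qed.

End Map.

Section Scaling.
Variables (f : fieldType) (R : comNzRingType) (iota : {rmorphism f -> R}) (c : R).
Implicit Types a b : {fps R}.

(** The substitution of c t for t. *)
Definition fps_scale a : {fps R} := Fps (fun i => c ^+ i * a i).

Lemma fps_scaleM a b : fps_scale (a * b) = fps_scale a * fps_scale b.
Proof.
apply: fpsP => k /=; rewrite mulr_sumr; apply: eq_bigr => i _.
have ik : (i <= k)%N by rewrite -ltnS.
by rewrite mulrACA -exprD subnKC.
Qed.

Lemma fps_scale1 : fps_scale 1 = 1.
Proof. by apply: fpsP => -[|k] /=; rewrite ?mul1r ?mulr0. Qed.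

Lemma fps_scaleX a n : fps_scale (a ^+ n) = fps_scale a ^+ n.
Proof. by elim: n => [|n IHn]; rewrite ?fps_scale1 // !exprS fps_scaleM IHn. Qed.

Lemma fps_scale_comp a b : fps_scale (fps_comp a b) = fps_comp a (fps_scale b).
Proof.
apply: fpsP => k /=; rewrite mulr_sumr; apply: eq_bigr => i _.
by rewrite -fps_scaleX /= mulrCA.
Qed.

Lemma fps_comp_scale a b : fps_comp a (fpsC c * b) = fps_comp (fps_scale a) b.
Proof.
apply: fpsP => k /=; apply: eq_bigr => i _.
by rewrite exprMn -rmorphXn fps_coefCM mulrCA mulrA.
Qed.

Lemma fps_scale_binpow a s :
  fps_scale (fps_binpow iota a s) = fps_binpow iota (fps_scale a) s.
Proof.
rewrite /fps_binpow fps_scale_comp; congr fps_comp.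
apply: fpsP => k /=; rewrite mulrDr mulrN; congr (_ - _).
by case: k => [|k]; rewrite ?mul1r // mulr0.
Qed.

(** Both series of the generating function have the form 1 + z A(c z), with c = x_0;
    the substitution of c z for z only multiplies coefficients by powers of c. *)
Lemma binpow_scaled_coef (A B : {fps R}) s n : B 0%N = 1 ->
  (forall i, B i.+1 = c ^+ i * A i) ->
  fps_binpow iota B s n =
  \sum_(j < n.+1) iota (binomial_fps s j) * c ^+ (n - j) * (A ^+ j) (n - j)%N.
Proof.
move=> B0 BA; have E : B - 1 = fpsX * fps_scale A.
  apply: fpsP => -[|i]; rewrite fps_coefXM.
    by rewrite -[LHS]/(B 0%N - 1) B0 subrr.
  by rewrite -[LHS]/(B i.+1 - 0) subr0 BA.
apply: eq_bigr => j _; rewrite E exprMn fps_coefXnM ifN -?leqNgt -1?ltnS //.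
by rewrite -fps_scaleX -mulrA.
Qed.

End Scaling.

Section Congruence.
Variables (f : fieldType) (R : comNzRingType) (iota : {rmorphism f -> R}).
Implicit Types a b g h : {fps R}.

Lemma binpow_cong1 n a s : fps_cong n a 1 -> fps_cong n (fps_binpow iota a s) 1.
Proof.
move=> a1; have a0 : fps_cong n (a - 1) (fpsC 0).
  by move=> i ltin; rewrite -[LHS]/(a i - _) a1 //= subrr mul0rn.
move=> i ltin; rewrite (fps_comp_congr _ a0) //.
have -> : fpsC 0 = fpsC 0 * fpsX :> {fps R} by rewrite rmorph0 mul0r.
rewrite fps_comp_scale fps_comp_idr [LHS](_ : _ = 0 ^+ i * iota (binomial_fps s i)) //.
by case: (i) => [|j]; rewrite ?binomial_fps0 ?rmorph1 ?mulr1 // expr0n mul0r.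
Qed.

Lemma comp_cong n g h : fps_cong n g fpsX -> fps_cong n (fps_comp h g) h.
Proof. by move=> gX i ltin; rewrite (fps_comp_congr _ gX) // fps_comp_idr. Qed.

Lemma gact_cong n lambda mu g h :
  fps_cong n.+1 g fpsX -> fps_cong n (gact iota lambda mu g h) h.
Proof.
move=> gX; have g1 : fps_cong n (fps_divX g) 1.
  by move=> i ltin; rewrite /= gX.
have g2 : fps_cong n (fps_deriv g) 1.
  by move=> i ltin; rewrite /= gX //; case: (i) => [|j]; rewrite ?mul0rn.
have gh : fps_cong n (fps_comp h g) h.
  by move=> i ltin; apply: (comp_cong _ gX); apply: ltnW.
move=> i ltin.
rewrite (fps_congM (fps_congM gh (binpow_cong1 _ g1)) (binpow_cong1 _ g2)) //.
by rewrite !mulr1.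
Qed.

End Congruence.

Section RelativeCoefficient.
Variables (f : fieldType) (alpha : f) (m k d : nat).

(** The series (u - u_0) / t, and its truncation. *)
Definition tail (R : comNzRingType) (u : nat -> R) : {fps R} :=
  Fps (fun i => u i.+1).
Definition tail_upto (R : comNzRingType) (u : nat -> R) : {fps R} :=
  Fps (fun i => if (i < m)%N then u i.+1 else 0).

(** For d = k this is P_(mk)^(alpha) at the point u.  For smaller d it is
    P_(mk)^(alpha) divided by u_0^(k-d), provided that the binomial coefficients
    of index d + 1, ..., k vanish. *)
Definition relcoef (R : comNzRingType) (iota : f -> R) (u : nat -> R) : R :=
  \sum_(j < d.+1) iota (binomial_fps alpha j) * u 0%N ^+ (d - j) *
    ((tail u ^+ j) (m + k - j)%N - (tail_upto u ^+ j) (m + k - j)%N).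

Definition relpoly : polyring f := relcoef (in_alg (polyring f)) (xvar f).

Lemma rmorph_relcoef (R S : comNzRingType) (phi : {rmorphism R -> S})
    (iota : f -> R) (iota' : f -> S) u :
  (forall c, phi (iota c) = iota' c) ->
  phi (relcoef iota u) = relcoef iota' (phi \o u).
Proof.
move=> phiE; rewrite rmorph_sum; apply: eq_bigr => j _.
rewrite rmorphM rmorphB rmorphM rmorphXn phiE; congr (_ * (_ - _)).
  by rewrite -[LHS]/(fps_map phi _ _) fps_mapX.
rewrite -[LHS]/(fps_map phi _ _) fps_mapX.
have -> : fps_map phi (tail_upto u) = tail_upto (phi \o u) => //.
by apply: fpsP => i /=; case: ifP => // _; rewrite rmorph0.
Qed.

Lemma peval_relpoly (R : comNzRingType) (iota : {rmorphism f -> R}) u :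
  peval iota u relpoly = relcoef iota u.
Proof.
rewrite (@rmorph_relcoef _ _ (peval iota u) _ iota) => [|c]; last exact: pevalC.
by congr relcoef; apply/funext => i; rewrite /= pevalX.
Qed.

(** The series u(u_0 z) / u_0, without the division. *)
Definition Yser (R : comNzRingType) (u : nat -> R) : {fps R} :=
  Fps (fun i => if i is j.+1 then u i * u 0%N ^+ j else 1).
Definition Yser_upto (R : comNzRingType) (u : nat -> R) : {fps R} :=
  Fps (fun i => if (i <= m)%N then Yser u i else 0).

Section Coefficients.
Variables (R : comNzRingType) (iota : {rmorphism f -> R}) (u : nat -> R).

Lemma tail_upto_cong : fps_cong m (tail u) (tail_upto u).
Proof. by move=> i /= ->. Qed.

Lemma Yser_diff_coef n :
  (fps_binpow iota (Yser u) alpha - fps_binpow iota (Yser_upto u) alpha) n =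
  \sum_(j < n.+1) iota (binomial_fps alpha j) * u 0%N ^+ (n - j) *
    ((tail u ^+ j) (n - j)%N - (tail_upto u ^+ j) (n - j)%N).
Proof.
rewrite -[LHS]/(fps_binpow iota (Yser u) alpha n
  - fps_binpow iota (Yser_upto u) alpha n).
rewrite (@binpow_scaled_coef _ _ iota (u 0%N) (tail u)) => [||i] //; last first.
  by rewrite /= mulrC.
rewrite (@binpow_scaled_coef _ _ iota (u 0%N) (tail_upto u)) => [||i] //.
  by rewrite -sumrB; apply: eq_bigr => j _; rewrite mulrBr.
by rewrite /=; case: ifP => _; rewrite ?mulr0 // mulrC.
Qed.

Lemma Yser_diff_low n : (n < m)%N ->
  (fps_binpow iota (Yser u) alpha - fps_binpow iota (Yser_upto u) alpha) n = 0.
Proof.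
move=> nm; rewrite Yser_diff_coef big1 // => j _.
rewrite (fps_congX j tail_upto_cong) ?subrr ?mulr0 //.
exact: leq_ltn_trans (leq_subr _ _) nm.
Qed.

Hypothesis le_dk : (d <= k)%N.
Hypothesis alpha_d :
  forall j, (d < j)%N -> (j <= k)%N -> binomial_fps alpha j = 0.

(** In the j-th term, the two series only enter through their powers at degree
    m + k - j, where they agree if j > k; for d < j <= k the term vanishes with
    its binomial coefficient. *)
Lemma Yser_diff_relcoef :
  (fps_binpow iota (Yser u) alpha - fps_binpow iota (Yser_upto u) alpha) (m + k)%N =
  u 0%N ^+ (m + k - d) * relcoef iota u.
Proof.
rewrite Yser_diff_coef mulr_sumr.
pose F j := iota (binomial_fps alpha j) * u 0%N ^+ (m + k - j) *
    ((tail u ^+ j) (m + k - j)%N - (tail_upto u ^+ j) (m + k - j)%N).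
have dmk : (d.+1 <= (m + k).+1)%N by rewrite ltnS (leq_trans le_dk) ?leq_addl.
rewrite -[LHS]/(\sum_(j < (m + k).+1) F j) (bigID (fun j : 'I_ _ => (j < d.+1)%N)).
rewrite /= [X in _ + X]big1 ?addr0 => [|j].
  rewrite -(big_ord_widen _ F dmk); apply: eq_bigr => j _.
  rewrite /F [RHS]mulrA [u 0%N ^+ _ * (_ * _)]mulrCA -exprD.
  by congr (_ * _ ^+ _ * _); move: (ltn_ord j) dmk; lia.
rewrite -leqNgt => dj; rewrite /F; have [jk|kj] := leqP j k.
  by rewrite alpha_d // rmorph0 !mul0r.
rewrite (fps_congX j tail_upto_cong) ?subrr ?mulr0 //.
by move: (ltn_ord j); lia.
Qed.

End Coefficients.
End RelativeCoefficient.

Section RelativeCoefficientTheory.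
Variables (f : fieldType) (alpha : f) (m k d : nat).
Variables (R : comNzRingType) (iota : {rmorphism f -> R}).
Implicit Types u v : nat -> R.
Hypothesis d_gt0 : (0 < d)%N.
Hypothesis le_dk : (d <= k)%N.

(** The top variable enters only the linear term: in the j-th power the other
    j - 1 factors have positive degree. *)
Lemma relcoef_top u v : (forall i, (i < m + k)%N -> u i = v i) ->
  relcoef alpha m k d iota u - relcoef alpha m k d iota v =
  iota alpha * u 0%N ^+ d.-1 * (u (m + k)%N - v (m + k)%N).
Proof.
move=> uv; have mk : (0 < m + k)%N by lia.
rewrite /relcoef -sumrB -(uv _ mk).
have up : tail_upto m u = tail_upto m v.
  apply: fpsP => i /=; case: ltnP => // im; apply: uv; lia.
have cong : fps_cong (m + k).-1 (tail u) (tail v).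
  by move=> i ik; apply: uv; lia.
pose G (w : nat -> R) j := (tail w ^+ j) (m + k - j)%N - (tail_upto m w ^+ j) (m + k - j)%N.
pose F (w : nat -> R) j := iota (binomial_fps alpha j) * u 0%N ^+ (d - j) * G w j.
rewrite -[LHS]/(\sum_(j < d.+1) (F u j - F v j)).
have -> : d.+1 = d.-1.+2 by lia.
have F0 : F u 0%N - F v 0%N = 0 by rewrite /F /G !expr0 !subrr.
have FS j : (j.+2 <= d)%N -> F u j.+2 - F v j.+2 = 0.
  move=> jd; have jk := leq_trans jd le_dk.
  rewrite /F /G -mulrBr up (fps_congX _ cong) ?subrr ?mulr0 //; lia.
rewrite 2!big_ord_recl F0 add0r big1 ?addr0 => [|j _]; last first.
  by apply: (FS j); have := ltn_ord j; lia.
rewrite /F /G -mulrBr binomial_fps1 up !expr1 -subn1; congr (_ * _).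
rewrite opprD addrACA opprK addNr addr0.
by rewrite /= /bump subn1 prednK.
Qed.

(** If also the top coordinate is 0, the truncation at degree m loses nothing that
    is seen at degree m + k. *)
Lemma relcoef_middle0 u : (forall i, (m < i < m + k)%N -> u i = 0) ->
  relcoef alpha m k d iota u = iota alpha * u 0%N ^+ d.-1 * u (m + k)%N.
Proof.
move=> u0; pose v i := if (i < m + k)%N then u i else 0.
have vtop : v (m + k)%N = 0 by rewrite /v ltnn.
have := @relcoef_top u v; rewrite vtop subr0 => <-; last first.
  by move=> i im; rewrite /v im.
suff -> : relcoef alpha m k d iota v = 0 by rewrite subr0.
rewrite /relcoef big1 // => -[j jd] _ /=.
suff -> : tail v = tail_upto m v by rewrite subrr mulr0.
apply: fpsP => i /=; case: ltnP => // mi; rewrite /v.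
by case: ltnP => // ik; apply: u0; rewrite ltnS mi.
Qed.

End RelativeCoefficientTheory.

Section Nonconstant.
Variables (f : fieldType) (alpha : f) (m k d : nat).
Hypothesis d_gt0 : (0 < d)%N.
Hypothesis le_dk : (d <= k)%N.
Hypothesis alpha_d : binomial_fps alpha d != 0.
Hypothesis char0 : [pchar f] =i pred0.

Let r := (m + k - d)%N.

(** Setting x_0 = 0 leaves only the term of degree d, and this is a nonconstant
    polynomial in the variable x_(m+k-d+1). *)
Lemma relcoef_line_nonconst (h : nat -> f) : h 0%N = 0 -> h 1%N != 0 ->
  (1 < size (relcoef alpha m k d polyC
     (fun i => if i == r.+1 then 'X else (h i)%:P)))%N.
Proof.
move=> h0 h1; set gamma := fun i => _.
pose g i := if i == r.+1 then 0 else h i.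
pose T : {fps {poly f}} := tail (polyC \o g).
have tailE : tail gamma = T + fpsC 'X * fpsX ^+ r.
  apply: fpsP => i; rewrite -[RHS]/(T i + _ i) fps_coefCM /= /gamma /g eqSS.
  rewrite -[fpsX ^+ r]mulr1 fps_coefXnM fps_coef1.
  have [->|ir] := eqVneq i r; first by rewrite ltnn subnn mulr1 add0r.
  case: ltnP => ri; first by rewrite mulr0 addr0.
  by rewrite subn_eq0 leqNgt ltn_neqAle eq_sym ir ri mulr0 addr0.
have [c cE] : exists c : f, (tail_upto m gamma ^+ d) r = c%:P.
  exists ((tail_upto m g ^+ d) r); rewrite -[RHS]/(fps_map polyC _ _) fps_mapX.
  congr (fps_coef (_ ^+ _) _); apply: fpsP => i /=; case: ltnP => // im.
  by rewrite /gamma /g; case: eqP => // E; exfalso; move: E im; rewrite /r; lia.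
have relE : relcoef alpha m k d polyC gamma =
    (binomial_fps alpha d)%:P * ((tail gamma ^+ d) r - c%:P).
  rewrite /relcoef big_ord_recr subnn mulr1 cE /= big1 ?add0r // => j _.
  by rewrite /gamma /= h0 expr0n subn_eq0 leqNgt ltn_ord mulr0 mul0r.
have Tconst n e : exists c : f, (T ^+ e) n = c%:P.
  exists ((tail g ^+ e) n); rewrite -[RHS]/(fps_map polyC _ _) fps_mapX.
  by congr (fps_coef (_ ^+ _) _); apply: fpsP.
suff [e [a [b [e_gt0 b0 powE]]]] : exists e a b,
    [/\ (0 < e)%N, b != 0 & (tail gamma ^+ d) r = a%:P + b *: 'X^e].
  rewrite relE powE mul_polyC; apply: (leq_ltn_trans e_gt0).
  rewrite ltnNge; apply: contra_neqN (mulf_neq0 alpha_d b0) => /leq_sizeP/(_ e (leqnn e)).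
  rewrite coefZ coefB coefD coefZ coefXn eqxx !coefC mulr1.
  by rewrite gtn_eqF // add0r subr0.
rewrite tailE; have [r0|r_gt0] := posnP r; last first.
  have [a aE] := Tconst r d; exists 1%N, a, (h 1%N ^+ d.-1 *+ d); split=> //.
    rewrite -mulr_natr mulf_neq0 ?expf_neq0 //.
    by rewrite -(prednK d_gt0) natf0.
  rewrite coef_pow_addXn // aE; congr (_ + _).
  have -> : T 0%N = (h 1%N)%:P by rewrite /= /g eqSS ltn_eqF.
  by rewrite -rmorphXn mulrC mul_polyC scalerMnl.
exists d, 0, 1; split=> //; first exact: oner_neq0.
have T0 : (T + fpsC 'X * fpsX ^+ 0) 0%N = 'X.
  by rewrite expr0 mulr1 /= /g r0 eqxx add0r.
by rewrite r0 fps_coefX0 T0 add0r scale1r.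
Qed.

End Nonconstant.

(** * Invariance of the generators *)

Section AbsoluteInvariants.
Variables (f : fieldType) (char0 : [pchar f] =i pred0) (lambda mu : f).
Implicit Types (p q : polyring f).

Lemma absolute_invariantX_lt m i :
  (i < m)%N -> absolute_invariant lambda mu m (xvar f i).
Proof.
move=> im R iota g h gX; rewrite !pevalX.
exact: (gact_cong iota lambda mu h gX).
Qed.

Lemma absolute_invariant_psubst m w p :
  (forall i, absolute_invariant lambda mu m (w i)) ->
  absolute_invariant lambda mu m (psubst w p).
Proof.
move=> winv R iota g h gX; rewrite !peval_psubst; apply: eq_peval => i.
exact: winv.
Qed.

(** It is enough to consider series with a nonzero constant term: the series
    h + X over R[X] has one, and X = 0 gives back h. *)
Lemma absolute_invariant_generic m p :
  (forall (R : idomainType) (iota : {rmorphism f -> R}) (g h : {fps R}),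
     h 0%N != 0 -> fps_cong m.+1 g fpsX ->
     peval iota (gact iota lambda mu g h) p = peval iota h p) ->
  absolute_invariant lambda mu m p.
Proof.
move=> pinv R iota g h gX.
pose iotaX := (polyC \o iota : {rmorphism f -> {poly R}})%FUN.
pose gP : {fps {poly R}} := fps_map polyC g.
pose hP : {fps {poly R}} := fps_map polyC h + fpsC 'X.
have evE c : horner_eval 0 (iotaX c) = iota c by rewrite /= /horner_eval hornerC.
have evg : fps_map (horner_eval 0) gP = g.
  by apply: fpsP => i; rewrite /= /horner_eval hornerC.
have evh : fps_map (horner_eval 0) hP = h.
  apply: fpsP => i; rewrite /= /horner_eval hornerD hornerC hornerMn hornerX.
  by rewrite mul0rn addr0.
have : peval iotaX (gact iotaX lambda mu gP hP) p = peval iotaX hP p.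
  apply: pinv => [|i im]; last by rewrite /= gX //= rmorph_nat.
  apply/eqP => /(congr1 (fun P : {poly R} => P`_1)).
  by rewrite coef0 /= coefD coefC coefX add0r => /eqP; rewrite oner_eq0.
move=> /(congr1 (horner_eval 0)); rewrite !(rmorph_peval _ _ evE) => E.
rewrite -[in RHS]evh -[RHS]E; apply: eq_peval => i.
rewrite -[RHS]/(fps_map (horner_eval 0) _ i) (fps_map_gact evE).
by rewrite evg evh.
Qed.

(** For alpha = - 1 / lambda, the factors of the action become the powers
    (g / t)^-(n+1) and g' of the invariant differential form Y^alpha t^-(n+1) dt,
    here with g = t v. *)
Lemma binpow_gact_coef (R : idomainType) (iota : {rmorphism f -> R})
    (Y v : {fps R}) n :
  lambda != 0 -> mu = n.+1%:R * lambda -> Y 0%N = 1 -> v 0%N = 1 ->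
  fps_binpow iota (gact iota lambda mu (fpsX * v) Y) (- lambda^-1) n =
  fps_binpow iota Y (- lambda^-1) n.
Proof.
move=> l0 muE Y0 v0.
have g0 : (fpsX * v) 0%N = 0 by rewrite fps_coefXM.
have dX : fps_divX (fpsX * v) = v.
  by apply: fpsP => i; rewrite -[LHS]/((fpsX * v) i.+1) fps_coefXM.
have d0 : fps_deriv (fpsX * v) 0%N = 1.
  by rewrite -[LHS]/((fpsX * v) 1%N *+ 1) fps_coefXM v0.
rewrite /gact dX -/(binpow iota _ _).
have pow0 a s : fps_binpow iota a s 0%N = 1 by exact: binpow_0.
have Yg0 : fps_comp Y (fpsX * v) 0%N = 1 by rewrite fps_comp_0.
rewrite (binpowMl char0) ?fps_coefM0 ?pow0 ?Yg0 ?mulr1 //.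
rewrite (binpowMl char0) ?pow0 ?Yg0 //.
rewrite (binpow_binpow char0 iota mu _ v0) (binpow_binpow char0 iota _ _ d0).
rewrite -(fps_comp_binpow char0 iota _ Y0 g0).
have -> : mu * - lambda^-1 = - n.+1%:R by rewrite muE mulrN mulfK.
have -> : - lambda * - lambda^-1 = 1 by rewrite mulrNN divff.
rewrite (binpow1 char0) // -mulrA.
exact: (residue_subst char0 iota).
Qed.

(** Replacing h by h(c z) / c, with c its constant term, conjugates the action of
    g(t) into that of g(c z) / c, which is again z plus higher terms. *)
Lemma Yser_gact (R : idomainType) (iota : {rmorphism f -> R}) (g h : {fps R}) :
  h 0%N != 0 -> fps_cong 2 g fpsX ->
  Yser (gact iota lambda mu g h) =
  gact iota lambda mu (fpsX * fps_scale (h 0%N) (fps_divX g)) (Yser h).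
Proof.
move=> h0 gX; set c := h 0%N; set w := fps_scale c _.
have YE (u : {fps R}) : u 0%N = c -> fpsC c * Yser u = fps_scale c u.
  move=> u0; apply: fpsP => -[|i]; rewrite fps_coefCM /= ?mulr1 ?mul1r //.
  by rewrite u0 exprS mulrCA mulrC.
have G0 : gact iota lambda mu g h 0%N = c.
  exact: (@gact_cong _ _ iota 1 lambda mu g h gX).
apply: (@mulfI _ (fpsC c)).
  by apply/eqP => /(congr1 (fun a : {fps R} => a 0%N)) /eqP; apply/negP.
have gE : fpsC c * (fpsX * w) = fps_scale c g.
  apply: fpsP => -[|i]; rewrite fps_coefCM fps_coefXM /=.
    by rewrite gX //= !mulr0.
  by rewrite mulrA -exprS.
have dX : fps_divX (fpsX * w) = fps_scale c (fps_divX g).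
  by apply: fpsP => i; rewrite -[LHS]/((fpsX * w) i.+1) fps_coefXM.
have dd : fps_deriv (fpsX * w) = fps_scale c (fps_deriv g).
  by apply: fpsP => i; rewrite -[LHS]/((fpsX * w) i.+1 *+ _) fps_coefXM /= mulrnAr.
rewrite YE // /gact dX dd -!fps_scale_binpow !mulrA !fps_scaleM.
congr (_ * _ * _); rewrite fps_scale_comp -gE fps_comp_scale -YE //.
by rewrite fps_compM ?fps_compC // fps_coefXM.
Qed.

Variables (m k d : nat).
Hypothesis lambda_neq0 : lambda != 0.
Hypothesis muE : mu = (m + k).+1%:R * lambda.
Hypothesis le_dk : (d <= k)%N.
Hypothesis alpha_d :
  forall j, (d < j)%N -> (j <= k)%N -> binomial_fps (- lambda^-1) j = 0.

(** The two truncated series are equal, as x_0, ..., x_m are invariant; so the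
    difference changes as little as the full binomial power does. *)
Lemma absolute_invariant_relpoly :
  absolute_invariant lambda mu m.+1 (relpoly (- lambda^-1) m k d).
Proof.
apply: absolute_invariant_generic => R iota g h h0 gX.
have YG : fps_binpow iota (Yser (gact iota lambda mu g h)) (- lambda^-1) (m + k)%N
    = fps_binpow iota (Yser h) (- lambda^-1) (m + k)%N.
  have gX2 : fps_cong 2 g fpsX by move=> i i2; apply: gX; rewrite (leq_trans i2).
  rewrite (Yser_gact iota h0 gX2).
  by apply: binpow_gact_coef => //; rewrite /= gX // mul1r.
have Gh := gact_cong iota lambda mu h gX.
rewrite !peval_relpoly.
move: (gact iota lambda mu g h) YG Gh => G YG Gh.
have G0 : G 0%N = h 0%N by apply: Gh.
have YGm : Yser_upto m G = Yser_upto m h.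
  apply: fpsP => i /=; case: (leqP i m) => //; case: i => // i im.
  by rewrite G0 Gh.
apply: (@mulfI _ (h 0%N ^+ (m + k - d))); first by rewrite expf_neq0.
have [EG Eh] := (Yser_diff_relcoef m iota G le_dk alpha_d,
                 Yser_diff_relcoef m iota h le_dk alpha_d).
rewrite -Eh -[in LHS]G0 -EG YGm.
exact: (congr1 (+%R^~ _) YG).
Qed.

End AbsoluteInvariants.

(** * Absence of other invariants *)

Section Tangent.
Variables (f : fieldType) (lambda mu : f).
Implicit Types (a h w : {fps f}).

Lemma L_actD a b h :
  L_act lambda mu (a + b) h = L_act lambda mu a h + L_act lambda mu b h.
Proof.
apply: fpsP => n /=; rewrite -big_split; apply: eq_bigr => i _.
by rewrite !mulrDl.
Qed.

Lemma L_act_single l x h n :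
  L_act lambda mu (fpsC x * fpsX ^+ l) h n =
  if (n < l)%N then 0
  else x * (h (n - l)%N * ((n - l)%:R + mu - lambda * l.+1%:R)).
Proof.
have aE i : (fpsC x * fpsX ^+ l) i = if i == l then x else 0.
  rewrite fps_coefCM -[fpsX ^+ l]mulr1 fps_coefXnM fps_coef1.
  have [->|il] := eqVneq i l; first by rewrite ltnn subnn mulr1.
  case: ltnP => li; first by rewrite mulr0.
  by rewrite subn_eq0 leqNgt ltn_neqAle eq_sym il li mulr0.
rewrite -[LHS]/(\sum_(i < n.+1) _); case: ltnP => ln.
  rewrite big1 // => i _; rewrite aE; case: eqP => [il|_]; rewrite ?mul0r //.
  by move: (ltn_ord i); rewrite il ltnS leqNgt ln.
have ln' : (l < n.+1)%N by rewrite ltnS.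
rewrite (bigD1 (Ordinal ln')) // aE eqxx big1 => [|i].
  by rewrite -mulrA; exact: addr0.
by rewrite -val_eqE aE => /negPf ->; rewrite !mul0r.
Qed.

Variables (m e : nat) (P : pred nat) (h w : {fps f}).
Hypothesis low : forall l i, (l < e)%N ->
  h l * (l%:R + mu - lambda * i.+1%:R) = 0.
Hypothesis lead : forall j, (m + e <= j)%N -> P j ->
  h e * (e%:R + mu - lambda * (j - e).+1%:R) != 0.
Hypothesis w_low : forall j, (j < m + e)%N -> w j = 0.

(** The components of the tangent vectors of an orbit can be prescribed one
    after the other, as l_(j-e) has its first component, of the form h_e times
    a scalar, at j. *)
Lemma L_act_solve N : exists2 a : {fps f}, (forall i, (i < m)%N -> a i = 0) &
  forall j, (j < N)%N -> P j -> L_act lambda mu a h j = w j.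
Proof.
have lowL a j : (forall i, (i < m)%N -> a i = 0) -> (j < m + e)%N ->
    L_act lambda mu a h j = 0.
  move=> a0 jm; rewrite [LHS]big1 // => i _.
  have [im|mi] := ltnP i m; first by rewrite a0 // !mul0r.
  by rewrite -mulrA low ?mulr0 //; move: (ltn_ord i); lia.
elim: N => [|N [a a0 aN]]; first by exists 0.
have [Nm|mN] := ltnP N (m + e).
  exists a => // j; rewrite ltnS leq_eqVlt => /predU1P[-> _|]; last exact: aN.
  by rewrite lowL // w_low.
have [PN|nPN] := boolP (P N); last first.
  exists a => // j; rewrite ltnS leq_eqVlt => /predU1P[-> PN|]; last exact: aN.
  by rewrite PN in nPN.
pose c := h e * (e%:R + mu - lambda * (N - e).+1%:R).
pose x := (w N - L_act lambda mu a h N) / c.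
exists (a + fpsC x * fpsX ^+ (N - e)) => [i im|j].
  rewrite -[LHS]/(a i + _ i) a0 // add0r fps_coefCM.
  by rewrite fps_coefX_lt ?mulr0 //; lia.
rewrite L_actD -[(_ + _ : {fps f}) j]/(L_act lambda mu a h j + _ j) L_act_single.
rewrite ltnS leq_eqVlt => /predU1P[-> _|jN Pj]; last first.
  rewrite aN //; case: ltnP => jNe; first by rewrite addr0.
  by rewrite low ?mulr0 ?addr0 //; lia.
rewrite ifN -?leqNgt ?leq_subr // subKn; last by lia.
by rewrite -/c /x divfK ?lead // addrC subrK.
Qed.

End Tangent.

Section UpperBound.
Variables (f : fieldType) (char0 : [pchar f] =i pred0) (lambda mu : f) (m : nat).
Implicit Types (p q : polyring f).

(** The curve scales the coordinates from m + 1 + e on by s; its tangent vectors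
    vanish on the earlier coordinates, hence are directions of the Lie algebra. *)
Lemma invariant_truncated e p :
  (forall l i, (l < e)%N -> l%:R + mu - lambda * i.+1%:R = 0) ->
  (forall j, (m.+1 + e <= j)%N -> e%:R + mu - lambda * (j - e).+1%:R != 0) ->
  invariants lambda mu m.+1 p -> psubst (truncvar f (m.+1 + e)) p = p.
Proof.
move=> low lead [_ pL]; have [N Np] := truncvar_ex p.
apply: (peval_inj char0 (i := e)) => h he; rewrite peval_psubst.
pose gamma i := if (i < m.+1 + e)%N then (h i)%:P else h i *: 'X.
transitivity (peval idfun (fun i => (gamma i).[0]) p).
  apply: eq_peval => i; rewrite /gamma /truncvar; case: ltnP => _.
    by rewrite pevalX hornerC.
  by rewrite rmorph0 hornerZ hornerX mulr0.
transitivity (peval idfun (fun i => (gamma i).[1]) p); last first.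
  apply: eq_peval => i; rewrite /gamma; case: ifP => _; first by rewrite hornerC.
  by rewrite hornerZ hornerX mulr1.
apply/esym/peval_path_const => // s.
set pt : {fps f} := Fps _; set w : {fps f} := Fps _.
have pte : pt e = h e by rewrite /= /gamma ltnS leq_addl hornerC.
have [||| a a0 aw] := @L_act_solve f lambda mu m.+1 e predT pt w _ _ _ N.
- by move=> l i le; rewrite low // mulr0.
- by move=> j mj _; rewrite pte mulf_neq0 ?lead.
- by move=> j jm; rewrite /= /gamma jm derivC hornerC.
rewrite (dir_deriv_truncvar _ Np (w := L_act lambda mu a pt)) ?pL // => i iN.
by rewrite aw.
Qed.

Variables (k d : nat).
Hypothesis lambda_neq0 : lambda != 0.
Hypothesis muE : mu = (m + k).+1%:R * lambda.
Hypothesis d_gt0 : (0 < d)%N.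
Hypothesis le_dk : (d <= k)%N.

Let alpha := - lambda^-1.
Let Q := relpoly alpha m k d.
Hypothesis alpha_d :
  forall j, (d < j)%N -> (j <= k)%N -> binomial_fps alpha j = 0.

Lemma alpha_neq0 : alpha != 0.
Proof. by rewrite oppr_eq0 invr_eq0. Qed.

Lemma relpoly_invariant : invariants lambda mu m.+1 Q.
Proof.
apply: absolute_invariant_invariants => //.
exact: absolute_invariant_relpoly.
Qed.

(** On the set where x_0 is not 0, every orbit meets the points whose coordinates
    above m vanish except for the one at m + k; there, the latter is determined by
    the value of Q. *)
Lemma invariant_normal_form p (h : nat -> f) :
  invariants lambda mu m.+1 p -> h 0%N != 0 ->
  peval idfun h p = peval idfun (fun i => if (i <= m)%N then h i
    else if i == (m + k)%N then peval idfun h Q / (alpha * h 0%N ^+ d.-1) else 0) p.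
Proof.
move=> [_ pL] h0; set y := peval idfun h Q; set n := (m + k)%N.
have mn : (m < n)%N by rewrite /n; lia.
have [N0 Np] := truncvar_ex p.
pose c := alpha * h 0%N ^+ d.-1.
have c0 : c != 0 by rewrite mulf_neq0 ?alpha_neq0 ?expf_neq0.
pose beta i := if (i <= m)%N then (h i)%:P else if i == n then 0 else h i *: 'X.
(* The top coordinate that makes Q equal to y along the curve. *)
pose top := (y%:P - relcoef alpha m k d polyC beta) * c^-1%:P.
pose gamma i := if i == n then top else beta i.
have gammaE i : i != n -> gamma i = beta i by rewrite /gamma => /negPf ->.
have gamma0 : gamma 0%N = (h 0%N)%:P by rewrite gammaE // neq_ltn (leq_ltn_trans _ mn).
have Qgamma : peval polyC gamma Q = y%:P.
  rewrite peval_relpoly; apply: (addIr (- relcoef alpha m k d polyC beta)).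
  rewrite relcoef_top // => [|i im]; last by rewrite gammaE // ltn_eqF.
  rewrite gamma0 -/n /gamma eqxx /beta leqNgt mn eqxx subr0 -rmorphXn -rmorphM.
  by rewrite -/c /top mulrCA -rmorphM mulfV // mulr1.
pose pt s : {fps f} := Fps (fun i => (gamma i).[s]).
have Qpt s : relcoef alpha m k d idfun (pt s) = y.
  rewrite -(peval_relpoly _ _ _ _ idfun); have := congr1 (horner_eval s) Qgamma.
  rewrite (@rmorph_peval _ _ _ _ _ idfun) => [|a]; last first.
    by rewrite /= /horner_eval hornerC.
  by rewrite /horner_eval hornerC.
have pt0 s : pt s 0%N = h 0%N by rewrite /= gamma0 hornerC.
have pt_low s i : (i <= m)%N -> pt s i = h i.
  by move=> im; rewrite /= gammaE ?ltn_eqF ?(leq_ltn_trans im) // /beta im hornerC.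
have const : peval idfun (pt 1) p = peval idfun (pt 0) p.
  apply: (@peval_path_const f char0 gamma p 1) => s; rewrite -/(pt s).
  set w : {fps f} := Fps _.
  have w_low j : (j < m.+1)%N -> w j = 0.
    move=> jm; rewrite /= gammaE ?ltn_eqF ?(leq_ltn_trans _ mn) //.
    by rewrite /beta -ltnS jm derivC hornerC.
  pose N := maxn N0 n.+1.
  have [||| a a0 aw] :=
      @L_act_solve f lambda mu m.+1 0 (predC1 n) (pt s) w _ _ _ N => //.
  - move=> j _ jn; rewrite pt0 mulf_neq0 // add0r subn0 muE mulrC -mulrBr.
    rewrite mulf_neq0 // subr_eq0 (inj_eq (natr_inj char0)) eqSS eq_sym.
    exact: jn.
  - by move=> j; rewrite addn0 => /w_low.
  set v := L_act lambda mu a (pt s) in aw.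
  have v_low j : (j < n)%N -> v j = w j.
    move=> jn; apply: aw; last by rewrite /= ltn_eqF.
    by rewrite /N leq_max ltnS (ltnW jn) orbT.
  (* L_act cannot prescribe the component at n, but v and w agree before n and
     both are tangent to the hypersurface Q = y. *)
  have vn : v n = w n.
    have := relpoly_invariant.2 a a0 (pt s).
    rewrite -/v => dv.
    have dw : dir_deriv Q (pt s) w = 0.
      by rewrite -[LHS](peval_path_deriv gamma Q s) Qgamma derivC hornerC.
    pose jet (z : {fps f}) i := (pt s i)%:P + z i *: 'X.
    have vw i : (i < n)%N -> jet v i = jet w i.
      by move=> im; rewrite /jet (v_low i im).
    have := congr1 (fun P : {poly f} => P`_1)
      (@relcoef_top f alpha m k d _ polyC d_gt0 le_dk (jet v) (jet w) vw).
    rewrite -!peval_relpoly coefB -/(dir_deriv Q (pt s) v) -/(dir_deriv Q (pt s) w).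
    have v0 : v 0%N = 0 by rewrite v_low ?w_low // (leq_ltn_trans _ mn).
    rewrite dv dw subrr /jet v0 scale0r addr0 pt0.
    rewrite -/n opprD addrACA subrr add0r -scalerBl -rmorphXn -rmorphM /= -/c.
    rewrite coefCM coefZ coefX mulr1 => E.
    by apply/eqP; rewrite -subr_eq0; apply/eqP/(mulfI c0); rewrite mulr0.
  rewrite (dir_deriv_truncvar _ Np (w := v)) ?pL // => i iN.
  have [->|jn] := eqVneq i n; first by rewrite vn.
  by apply/esym/aw => //; rewrite /N leq_max iN.
transitivity (peval idfun (pt 1) p).
  apply: eq_peval => i; have [->|jn] := eqVneq i n.
    have := @relcoef_top f alpha m k d _ idfun d_gt0 le_dk h (pt 1).
    rewrite Qpt -(peval_relpoly _ _ _ _ idfun) -/y subrr -/n => E.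
    apply/esym/eqP; rewrite eq_sym -subr_eq0; apply/eqP/(mulfI c0).
    rewrite mulr0 E // => j jn; rewrite /= gammaE ?ltn_eqF // /beta ltn_eqF //.
    by case: ifP; rewrite ?hornerC // hornerZ hornerX mulr1.
  rewrite /= gammaE // /beta (negPf jn).
  by case: ifP; rewrite ?hornerC // hornerZ hornerX mulr1.
rewrite const; apply: eq_peval => i; case: ifP => im; first exact: pt_low.
case: eqP => [->|/eqP jn]; last first.
  by rewrite /= gammaE // /beta im (negPf jn) hornerZ hornerX mulr0.
apply: (mulfI c0); rewrite [RHS]mulrC divfK // -(Qpt 0).
rewrite relcoef_middle0 ?pt0 // => j /andP[mj jn].
rewrite /= gammaE ?ltn_eqF // /beta leqNgt mj /= ltn_eqF //.
by rewrite hornerZ hornerX mulr0.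
Qed.

Definition adjoin i := if (i <= m)%N then xvar f i else Q.

(** Clearing the denominators that the normal form has. *)
Lemma normal_form_homogenize p : exists M (q : polyring f),
  forall (h : nat -> f) y, h 0%N != 0 ->
  h 0%N ^+ M * peval idfun (fun i => if (i <= m)%N then h i
    else if i == (m + k)%N then y / (alpha * h 0%N ^+ d.-1) else 0) p =
  peval idfun (fun i => if (i <= m)%N then h i else y) q.
Proof.
elim/polyring_ind: p => [c|i|p q [M [p' Ep]] [M' [q' Eq]]
    |p q [M [p' Ep]] [M' [q' Eq]]].
- by exists 0%N, c%:A => h y _; rewrite !pevalC mul1r.
- have [im|mi] := leqP i m.
    by exists 0%N, (xvar f i) => h y _; rewrite !pevalX im mul1r.
  have [->|ik] := eqVneq i (m + k)%N; last first.
    exists 0%N, 0 => h y _; rewrite pevalX leqNgt mi /= (negPf ik) mulr0.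
    by rewrite rmorph0.
  exists d.-1, (alpha^-1%:A * xvar f m.+1) => h y h0.
  rewrite pevalM pevalC !pevalX ltnn eqxx leqNgt ifF; last by lia.
  by rewrite /= invfM; field; rewrite expf_neq0 // alpha_neq0.
- exists (M + M')%N, (xvar f 0 ^+ M' * p' + xvar f 0 ^+ M * q') => h y h0.
  have X0 M0 : peval idfun (fun i => if (i <= m)%N then h i else y) (xvar f 0 ^+ M0)
      = h 0%N ^+ M0 by rewrite pevalXn pevalX.
  rewrite [RHS]pevalD [X in _ = X + _]pevalM [X in _ = _ + X]pevalM.
  rewrite !X0 -Ep // -Eq // pevalD mulrDr [in RHS]mulrA [X in _ = _ + X]mulrA.
  by rewrite -!exprD [(M' + M)%N]addnC.
- exists (M + M')%N, (p' * q') => h y h0.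
  move: (Ep h y h0) (Eq h y h0); rewrite !pevalM => <- <-.
  by rewrite exprD mulrACA.
Qed.

Lemma invariant_localized p : invariants lambda mu m.+1 p ->
  exists M q, xvar f 0 ^+ M * p = psubst adjoin q.
Proof.
move=> pI; have [M [q Eq]] := normal_form_homogenize p; exists M, q.
apply: (peval_inj char0 (i := 0)) => h h0.
rewrite pevalM pevalXn pevalX (invariant_normal_form pI h0) Eq //.
rewrite peval_psubst; apply: eq_peval => i; rewrite /adjoin; case: ifP => _ //.
by rewrite pevalX.
Qed.

Hypothesis alpha_d_neq0 : binomial_fps alpha d != 0.

(** Modulo x_0, q gives an algebraic relation of Q over x_1, ..., x_m.  For generic
    x_1, ..., x_m there is a line on which Q takes the values of a nonconstant
    polynomial, so that this relation is trivial; this means that q can be chosen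
    divisible by x_0. *)
Lemma adjoin_saturated p q : xvar f 0 * p = psubst adjoin q ->
  exists q', p = psubst adjoin q'.
Proof.
move=> pq.
(* The substitution of adjoin identifies all variables above m; q1 involves only
   the first of them. *)
pose s i := xvar f (minn i m.+1); set q1 := psubst s q.
have q1E : psubst adjoin q1 = xvar f 0 * p.
  rewrite pq psubst_comp; apply: eq_psubst => i; rewrite psubstX /adjoin geq_min.
  have [im|mi] := leqP i m; last by rewrite ltnn.
  by rewrite (minn_idPl _) // leqW.
have q0 : psubst (killvar f 0) q1 = 0.
  apply: (peval_eq0 char0 (i := 1)) => h h1.
  pose g i := if i == 0%N then 0 else h i.
  pose r := (m + k - d)%N.
  pose gamma i := if i == r.+1 then 'X else (g i)%:P.
  (* The relation as a polynomial in Q, at the chosen values of x_1, ..., x_m. *)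
  pose K := peval polyC (fun i => if (i <= m)%N then (g i)%:P else 'X) q.
  have K0 : K = 0.
    have size_gt1 : (1 < size (relcoef alpha m k d polyC gamma))%N.
      exact: relcoef_line_nonconst.
    apply/eqP; rewrite -(comp_poly_eq0 _ size_gt1).
    apply/eqP; rewrite -[LHS]/(comp_poly _ K).
    rewrite (@rmorph_peval _ _ _ _ _ polyC) => [|c]; last by rewrite /= comp_polyC.
    transitivity (peval polyC gamma (psubst adjoin q)); last first.
      by rewrite -pq pevalM pevalX /gamma /g /= mul0r.
    rewrite peval_psubst; apply: eq_peval => i; rewrite /adjoin /=.
    case: ifP => im; last by rewrite comp_polyX peval_relpoly.
    by rewrite pevalX comp_polyC /gamma ltn_eqF // /r; lia.
  have : K.[g m.+1] = 0 by rewrite K0 horner0.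
  rewrite -[K.[_]]/(horner_eval _ K) (@rmorph_peval _ _ _ _ _ idfun) => [<-|c]; last first.
    by rewrite /= /horner_eval hornerC.
  rewrite !peval_psubst; apply: eq_peval => i; rewrite /s /= pevalX /killvar.
  rewrite /horner_eval; have -> : peval idfun h (if minn i m.+1 == 0%N then 0
      else xvar f (minn i m.+1)) = g (minn i m.+1).
    by rewrite /g; case: eqP => _; rewrite ?rmorph0 ?pevalX.
  have [im|mi] := leqP i m; first by rewrite hornerC (minn_idPl _) // leqW.
  by rewrite hornerX (minn_idPr _).
have [q' q'E] := psubst_killvar 0 q1; rewrite q0 add0r in q'E.
exists q'; apply: (peval_inj char0 (i := 0)) => h h0; apply: (mulfI h0).
transitivity (peval idfun h (xvar f 0 * p)); first by rewrite pevalM pevalX.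
by rewrite -q1E q'E psubstM psubstX pevalM pevalX.
Qed.

Lemma invariant_adjoin p :
  invariants lambda mu m.+1 p -> exists q, p = psubst adjoin q.
Proof.
move=> /invariant_localized[M]; elim: M p => [|M IHM] p [q].
  by rewrite mul1r => ->; exists q.
rewrite exprS -mulrA => /adjoin_saturated[q' E].
by apply: (IHM p); exists q'.
Qed.

Lemma invariants_adjoin :
  invariants lambda mu m.+1 =
  subalg_gen ([set xvar f i | i in [set i : nat | (i <= m)%N]] `|` [set Q]).
Proof.
have -> : [set xvar f i | i in [set i : nat | (i <= m)%N]] `|` [set Q]
    = range adjoin.
  apply/seteqP; split=> [_ [[i im <-]|->]|_ [i _ <-]].
  - by exists i => //; rewrite /adjoin im.
  - by exists m.+1 => //; rewrite /adjoin ltnn.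
  - by rewrite /adjoin; case: ifP => im; [left; exists i|right].
rewrite subalg_gen_range; apply/seteqP.
split=> [p /invariant_adjoin[q ->]|_ [q _ <-]].
  by exists q.
apply: absolute_invariant_invariants => //.
apply: absolute_invariant_psubst => i; rewrite /adjoin; case: ifP => im.
  exact: absolute_invariantX_lt.
exact: absolute_invariant_relpoly.
Qed.

End UpperBound.

(** * The generating function and the theorem *)

Section GeneratingFunctionTheory.
Variables (f : fieldType) (char0 : [pchar f] =i pred0).
Implicit Types alpha : f.

Definition genfun alpha m : {fps polyring f} :=
  Fps (fun k => relpoly alpha m k k).

Lemma fps_coefCXM (R : comNzRingType) (c : R) (a : {fps R}) m n :
  (fpsC c * fpsX ^+ m * a) n = if (n < m)%N then 0 else c * a (n - m)%N.
Proof.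
by rewrite -mulrA fps_coefCM fps_coefXnM; case: ifP; rewrite ?mulr0.
Qed.

Lemma Yseries_diff_coef alpha m k :
  (fps_binpow (in_alg (polyring f)) (Yseries f) alpha
    - fps_binpow (in_alg (polyring f)) (Yseries_upto f m) alpha) (m + k)%N =
  xvar f 0 ^+ m * genfun alpha m k.
Proof.
etransitivity.
  apply: (@Yser_diff_relcoef f alpha m k k _ (in_alg (polyring f)) (xvar f) (leqnn k)).
  by move=> j kj jk; move: (leq_trans kj jk); rewrite ltnn.
by rewrite addnK.
Qed.

Lemma is_genfun_coef alpha m (P : {fps polyring f}) : is_genfun m alpha P ->
  forall k, xvar f 0 ^+ m * P k = xvar f 0 ^+ m * genfun alpha m k.
Proof.
move=> [_ PE] k; rewrite -Yseries_diff_coef -PE fps_coefCXM.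
rewrite ifF; last by rewrite ltnNge leq_addr.
by rewrite addKn.
Qed.

Lemma is_genfun_genfun alpha m : is_genfun m alpha (genfun alpha m).
Proof.
split; first by rewrite [LHS]big_ord1 !expr0 subrr mulr0.
apply: fpsP => n; rewrite fps_coefCXM; case: ltnP => nm.
  by apply/esym/(Yser_diff_low alpha (in_alg (polyring f)) (xvar f) nm).
by rewrite -Yseries_diff_coef subnKC.
Qed.

Lemma unique_genfun alpha m : unique (is_genfun m alpha) (genfun alpha m).
Proof.
split=> [|P /is_genfun_coef PE]; first exact: is_genfun_genfun.
apply: fpsP => k; apply: (mulfI_xvarX char0 (i := 0) (n := m)).
exact/esym/PE.
Qed.

Lemma relpoly_factor alpha m k d : (d <= k)%N ->
  (forall j, (d < j)%N -> (j <= k)%N -> binomial_fps alpha j = 0) ->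
  xvar f 0 ^+ (k - d) * relpoly alpha m k d = genfun alpha m k.
Proof.
move=> dk alpha_d; apply: (mulfI_xvarX char0 (i := 0) (n := m)).
rewrite -Yseries_diff_coef mulrA -exprD addnBA //.
by apply/esym/(@Yser_diff_relcoef f alpha m k d _ (in_alg (polyring f))).
Qed.

End GeneratingFunctionTheory.

Section FreeInvariants.
Variables (f : fieldType) (char0 : [pchar f] =i pred0) (lambda mu : f) (m : nat).

(** For lambda = mu = 0 the action is the mere substitution of g, which agrees
    with t one degree further than g / t agrees with 1. *)
Lemma absolute_invariantX_scalar i : (i <= m.+1)%N ->
  absolute_invariant (0 : f) 0 m.+1 (xvar f i).
Proof.
move=> im R iota g h gX; rewrite !pevalX.
have pow0 (a : {fps R}) : a 0%N = 1 -> fps_binpow iota a 0 = 1 by apply: binpow0.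
have -> : gact iota 0 0 g h = fps_comp h g.
  rewrite /gact oppr0 (pow0 (fps_divX g)) ?(pow0 (fps_deriv g)) ?mulr1 //.
    by rewrite /= gX.
  by rewrite /= gX.
exact: (comp_cong h gX).
Qed.

Lemma invariants_variables n :
  (forall i, (i <= n)%N -> absolute_invariant lambda mu m.+1 (xvar f i)) ->
  (forall p, invariants lambda mu m.+1 p -> psubst (truncvar f n.+1) p = p) ->
  invariants lambda mu m.+1 =
  subalg_gen [set xvar f i | i in [set i : nat | (i <= n)%N]].
Proof.
move=> xinv trunc; pose w i := xvar f (minn i n).
have -> : [set xvar f i | i in [set i : nat | (i <= n)%N]] = range w.
  apply/seteqP; split=> [_ [i im <-]|_ [i _ <-]].
    by exists i; [|rewrite /w (minn_idPl im)].
  by exists (minn i n); [exact: geq_minr|].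
rewrite subalg_gen_range; apply/seteqP; split=> [p pI|_ [q _ <-]].
  exists p; first by [].
  rewrite -{1}(trunc p pI) psubst_comp -[RHS](trunc p pI).
  apply: eq_psubst => i; rewrite /truncvar ltnS; case: leqP => im.
    by rewrite psubstX /w (minn_idPl im).
  exact: psubst0.
apply: absolute_invariant_invariants => //.
by apply: absolute_invariant_psubst => i; apply: xinv; apply: geq_minr.
Qed.

End FreeInvariants.

Theorem theorem4 (f : fieldType) (char0 : [pchar f] =i pred0)
    (lambda mu : f) (m : nat) :
  let x_upto (n : nat) : set (polyring f) :=
    [set xvar f i | i in [set i : nat | (i <= n)%N]] in
  let I : set (polyring f) := invariants lambda mu m.+1 in
  [/\ (forall k : nat, (0 < k)%N -> mu <> (m + k + 1)%:R * lambda) ->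
        I = subalg_gen (x_upto m),
      lambda = 0 -> mu = 0 ->
        I = subalg_gen (x_upto m.+1),
      forall k : nat, (0 < k)%N -> lambda <> 0 ->
        mu = (m + k + 1)%:R * lambda ->
        (forall n : nat, (0 < n)%N -> (n < k)%N -> - lambda^-1 <> n%:R) ->
        exists P : {fps polyring f},
          unique (is_genfun m (- lambda^-1)) P /\
          I = subalg_gen (x_upto m `|` [set P k])
    & forall n k : nat, (0 < n)%N -> (n < k)%N -> - lambda^-1 = n%:R ->
        mu = (m + k + 1)%:R * lambda ->
        exists (P : {fps polyring f}) (Q : polyring f),
          [/\ unique (is_genfun m n%:R) P,
              xvar f 0 ^+ (k - n) * Q = P k
            & I = subalg_gen (x_upto m `|` [set Q])]].
Proof.
move=> x_upto I; split.
- move=> muN; apply: invariants_variables => [i im|p pI].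
    exact: absolute_invariantX_lt.
  have := @invariant_truncated f char0 lambda mu m 0 p; rewrite addn0.
  apply=> // j mj; rewrite add0r subn0 subr_eq0 mulrC; apply/eqP.
  by have := muN (j - m)%N; rewrite subn_gt0 subnKC ?addn1 ?(ltnW mj) //; apply.
- move=> l0 mu0; apply: invariants_variables => [i im|p pI].
    by rewrite l0 mu0; apply: absolute_invariantX_scalar.
  have := @invariant_truncated f char0 lambda mu m 1 p; rewrite addn1.
  apply=> // [l i|j _]; rewrite l0 mu0 mul0r subr0 addr0; last exact: oner_neq0.
  by rewrite ltnS leqn0 => /eqP ->.
- move=> k k_gt0 /eqP l0 muE alphaN; exists (genfun (- lambda^-1) m).
  split; first exact: unique_genfun.
  apply: invariants_adjoin => // [|j kj jk|].
  + by rewrite muE addn1.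
  + by move: (leq_trans kj jk); rewrite ltnn.
  + apply: binomial_fps_neq0 => // -[|i] ik; last by apply/eqP/alphaN.
    by rewrite oppr_eq0 invr_eq0.
- move=> n k n_gt0 nk alphaE muE; exists (genfun (n%:R : f) m).
  have l0 : lambda != 0.
    apply: contra_eq_neq alphaE => ->; rewrite invr0 oppr0 eq_sym.
    by rewrite -(prednK n_gt0) natf0.
  have alpha_n j : (n < j)%N -> (j <= k)%N -> binomial_fps (n%:R : f) j = 0.
    by move=> nj _; apply: binomial_fps_eq0.
  exists (relpoly (n%:R : f) m k n); split; first exact: unique_genfun.
    by apply: relpoly_factor => //; apply: ltnW.
  rewrite /I -alphaE; apply: invariants_adjoin => //.
  + by rewrite muE addn1.
  + exact: ltnW.
  + by rewrite alphaE.
  + rewrite alphaE; apply: binomial_fps_neq0 => // i ik.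
    by rewrite (inj_eq (natr_inj char0)) neq_ltn ik orbT.
Qed.
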